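(* Consider the magnetic geodesic flow on the 2-torus of a Riemannian metric $ds^2=\Lambda(x,y)(dx^2+dy^2)$ with non-zero magnetic form $\Omega\,dx\wedge dy$ (that is, $\Omega\not\equiv0$). Suppose that the magnetic flow admits a first integral $F_2$ on all energy levels (i.e. on the whole phase space) which is quadratic in momenta. Then in some coordinates, again denoted $(x,y)$ with conjugate momenta $(p_1,p_2)$, the metric and the magnetic form are $$ds^2=\Lambda(y)(dx^2+dy^2),\qquad \Omega\,dx\wedge dy=-u'(y)\,dx\wedge dy$$ for some function $u$ of one variable; consequently there exists another first integral, linear in momenta, $$F_1=p_1+u(y),$$ and $F_2$ can be written as a combination of $H$ and $F_1$, i.e. $F_2=P(H,F_1)$ for some polynomial $P$ in two variables with constant coefficients.
   Context: All objects are smooth. The magnetic geodesic flow on the 2-torus with (global) conformal coordinates $(x,y)=(x^1,x^2)$ on its universal cover, metric $ds^2=\Lambda(dx^2+dy^2)$, $\Lambda>0$, and magnetic form $\Omega(x,y)\,dx\wedge dy$, is the Hamiltonian system $\dot x^j=\{x^j,H\}_{mg}$, $\dot p_j=\{p_j,H\}_{mg}$ $(j=1,2)$, with $H=\frac{1}{2\Lambda}(p_1^2+p_2^2)$ and Poisson bracket $$\{F,H\}_{mg}=\sum_{i=1}^2\left(\frac{\partial F}{\partial x^i}\frac{\partial H}{\partial p_i}-\frac{\partial F}{\partial p_i}\frac{\partial H}{\partial x^i}\right)+\Omega\left(\frac{\partial F}{\partial p_1}\frac{\partial H}{\partial p_2}-\frac{\partial F}{\partial p_2}\frac{\partial H}{\partial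 p_1}\right).$$ Here $\Lambda$ and $\Omega$ are functions on the torus. A first integral (on all energy levels) is a function $F$ on the phase space (the cotangent bundle of the torus) with $\{F,H\}_{mg}=0$ everywhere, which is functionally independent of $H$ almost everywhere. ''Quadratic in momenta'' means $$F_2=a_0p_1^2+2a_1p_1p_2+a_2p_2^2+b_0p_1+b_1p_2+c_0$$ with coefficients $a_i,b_i,c_0$ depending on $(x,y)$, being functions on the torus in the given coordinates. *)

(* Defs.v *)
(* Calculus is done with Coquelicot over the Stdlib reals; almost-everywhere
   statements use the Lebesgue measure of MathComp-Analysis on the same type R,
   which Rstruct makes a realType. *)
From mathcomp Require Import all_boot all_algebra.
From mathcomp Require Import all_classical all_reals all_analysis.
From mathcomp Require Import Rstruct Rstruct_topology.
From Stdlib Require Import Reals.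
From Coquelicot Require Import Coquelicot.

Set Implicit Arguments.
Unset Strict Implicit.
Unset Printing Implicit Defensive.

Open Scope R_scope.

Definition smooth1 (f : R -> R) : Prop :=
  forall (n : nat) (x : R), ex_derive_n f n x.

Definition smooth2 (f : R -> R -> R) : Prop :=
  forall (n : nat) (x y : R), ex_diff_n f n x y.

Definition D1 (f : R -> R -> R) (x y : R) : R := Derive (fun t => f t y) x.
Definition D2 (f : R -> R -> R) (x y : R) : R := Derive (fun t => f x t) y.

(* Functions on the phase space are written in the canonical coordinates
   (x, y, p1, p2) of the cotangent bundle of the universal cover R^2. *)
Definition phase_fun : Type := R -> R -> R -> R -> R.

Definition dx (F : phase_fun) : phase_fun :=
  fun x y p1 p2 => Derive (fun t => F t y p1 p2) x.
Definition dy (F : phase_fun) : phase_fun :=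
  fun x y p1 p2 => Derive (fun t => F x t p1 p2) y.
Definition dp1 (F : phase_fun) : phase_fun :=
  fun x y p1 p2 => Derive (fun t => F x y t p2) p1.
Definition dp2 (F : phase_fun) : phase_fun :=
  fun x y p1 p2 => Derive (fun t => F x y p1 t) p2.

(* The four-variable analogue of Coquelicot's ex_diff_n. *)
Fixpoint ex_diff4_n (F : phase_fun) (n : nat) (x y p1 p2 : R) : Prop :=
  continuous (fun z : (R * R) * (R * R) =>
                F (fst (fst z)) (snd (fst z)) (fst (snd z)) (snd (snd z)))
             ((x, y), (p1, p2)) /\
  match n with
  | O => True
  | S m =>
      (ex_derive (fun t => F t y p1 p2) x /\
       ex_derive (fun t => F x t p1 p2) y /\
       ex_derive (fun t => F x y t p2) p1 /\
       ex_derive (fun t => F x y p1 t) p2) /\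
      (ex_diff4_n (dx F) m x y p1 p2 /\
       ex_diff4_n (dy F) m x y p1 p2 /\
       ex_diff4_n (dp1 F) m x y p1 p2 /\
       ex_diff4_n (dp2 F) m x y p1 p2)
  end.

Definition smooth4 (F : phase_fun) : Prop :=
  forall (n : nat) (x y p1 p2 : R), ex_diff4_n F n x y p1 p2.

(* The torus is R^2 / (Z w1 + Z w2) with w1, w2 an arbitrary basis of R^2;
   functions on it are doubly periodic functions on R^2. *)
Definition is_basis (w1 w2 : R * R) : Prop :=
  fst w1 * snd w2 - snd w1 * fst w2 <> 0.

Definition torus_fun (w1 w2 : R * R) (f : R -> R -> R) : Prop :=
  smooth2 f /\
  forall x y : R,
    f (x + fst w1) (y + snd w1) = f x y /\ f (x + fst w2) (y + snd w2) = f x y.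

(* Translations act on the cotangent bundle leaving (p1, p2) unchanged. *)
Definition torus_phase_fun (w1 w2 : R * R) (F : phase_fun) : Prop :=
  smooth4 F /\
  forall x y p1 p2 : R,
    F (x + fst w1) (y + snd w1) p1 p2 = F x y p1 p2 /\
    F (x + fst w2) (y + snd w2) p1 p2 = F x y p1 p2.

(* The metric Lam (dx^2 + dy^2) and the magnetic form Om dx /\ dy. *)
Record magnetic_torus (w1 w2 : R * R) (Lam Om : R -> R -> R) : Prop := {
  mt_basis : is_basis w1 w2;
  mt_Lam : torus_fun w1 w2 Lam;
  mt_Lam_pos : forall x y : R, 0 < Lam x y;
  mt_Om : torus_fun w1 w2 Om
}.

Definition Ham (Lam : R -> R -> R) : phase_fun :=
  fun x y p1 p2 => / (2 * Lam x y) * (p1 ^ 2 + p2 ^ 2).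

Definition mg_bracket (Om : R -> R -> R) (F H : phase_fun) : phase_fun :=
  fun x y p1 p2 =>
    (dx F x y p1 p2 * dp1 H x y p1 p2 - dp1 F x y p1 p2 * dx H x y p1 p2)
    + (dy F x y p1 p2 * dp2 H x y p1 p2 - dp2 F x y p1 p2 * dy H x y p1 p2)
    + Om x y *
      (dp1 F x y p1 p2 * dp2 H x y p1 p2 - dp2 F x y p1 p2 * dp1 H x y p1 p2).

(* Linear independence of the differentials of F and G at a point. *)
Definition independent_at (F G : phase_fun) (x y p1 p2 : R) : Prop :=
  forall a b : R,
    a * dx F x y p1 p2 + b * dx G x y p1 p2 = 0 ->
    a * dy F x y p1 p2 + b * dy G x y p1 p2 = 0 ->
    a * dp1 F x y p1 p2 + b * dp1 G x y p1 p2 = 0 ->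
    a * dp2 F x y p1 p2 + b * dp2 G x y p1 p2 = 0 ->
    a = 0 /\ b = 0.

(* For lattice-periodic F and G, "almost everywhere" on the cotangent bundle of
   the torus is the same as almost everywhere on its universal cover R^4. *)
Definition independent_ae (F G : phase_fun) : Prop :=
  {ae ((@lebesgue_measure R \x @lebesgue_measure R) \x
       (@lebesgue_measure R \x @lebesgue_measure R))%E,
   forall z : (R * R) * (R * R),
     independent_at F G (fst (fst z)) (snd (fst z)) (fst (snd z)) (snd (snd z))}.

Record first_integral (w1 w2 : R * R) (Lam Om : R -> R -> R) (F : phase_fun) :
    Prop := {
  fi_phase : torus_phase_fun w1 w2 F;
  fi_bracket : forall x y p1 p2 : R, mg_bracket Om F (Ham Lam) x y p1 p2 = 0;
  fi_independent : independent_ae F (Ham Lam)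
}.

Definition quadratic_in_momenta (w1 w2 : R * R) (F : phase_fun) : Prop :=
  exists a0 a1 a2 b0 b1 c0 : R -> R -> R,
    (torus_fun w1 w2 a0 /\ torus_fun w1 w2 a1 /\ torus_fun w1 w2 a2 /\
     torus_fun w1 w2 b0 /\ torus_fun w1 w2 b1 /\ torus_fun w1 w2 c0) /\
    forall x y p1 p2 : R,
      F x y p1 p2 =
        a0 x y * p1 ^ 2 + 2 * a1 x y * p1 * p2 + a2 x y * p2 ^ 2
        + b0 x y * p1 + b1 x y * p2 + c0 x y.

(* New coordinates (X, Y) on the universal cover: a diffeomorphism of R^2 that
   carries the lattice translations by w1, w2 to those by v1, v2, so that in the
   new coordinates the same torus is R^2 / (Z v1 + Z v2). *)
Record coordinate_change (w1 w2 v1 v2 : R * R) (X Y : R -> R -> R) : Prop := {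
  cc_smooth : smooth2 X /\ smooth2 Y;
  cc_inverse : exists Xi Yi : R -> R -> R,
    (smooth2 Xi /\ smooth2 Yi) /\
    (forall x y : R, Xi (X x y) (Y x y) = x /\ Yi (X x y) (Y x y) = y) /\
    (forall s t : R, X (Xi s t) (Yi s t) = s /\ Y (Xi s t) (Yi s t) = t);
  cc_lattice1 : forall x y : R,
    X (x + fst w1) (y + snd w1) = X x y + fst v1 /\
    Y (x + fst w1) (y + snd w1) = Y x y + snd v1;
  cc_lattice2 : forall x y : R,
    X (x + fst w2) (y + snd w2) = X x y + fst v2 /\
    Y (x + fst w2) (y + snd w2) = Y x y + snd v2
}.

(* Lam (dx^2 + dy^2) = Lam' (dX^2 + dY^2), evaluated on tangent vectors (a, b). *)
Definition same_metric (X Y Lam Lam' : R -> R -> R) : Prop :=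
  forall x y a b : R,
    Lam x y * (a ^ 2 + b ^ 2) =
    Lam' (X x y) (Y x y) *
      ((D1 X x y * a + D2 X x y * b) ^ 2 + (D1 Y x y * a + D2 Y x y * b) ^ 2).

(* Om dx /\ dy = Om' dX /\ dY. *)
Definition same_form (X Y Om Om' : R -> R -> R) : Prop :=
  forall x y : R,
    Om x y =
    Om' (X x y) (Y x y) * (D1 X x y * D2 Y x y - D2 X x y * D1 Y x y).

(* F in the old canonical coordinates and F' in the new ones are the same
   function on the cotangent bundle; the conjugate momenta are related by
   p1 dx + p2 dy = P1 dX + P2 dY. *)
Definition same_phase_fun (X Y : R -> R -> R) (F F' : phase_fun) : Prop :=
  forall x y P1 P2 : R,
    F x y (P1 * D1 X x y + P2 * D1 Y x y) (P1 * D2 X x y + P2 * D2 Y x y) =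
    F' (X x y) (Y x y) P1 P2.

(* Value at (h, f) of a polynomial in two variables: the outer variable is h. *)
Definition eval2 (P : {poly {poly R}}) (h f : R) : R :=
  horner (horner P (polyC h)) f.

(* Main.v *)
Require Import Defs.
From mathcomp Require Import all_boot all_algebra.
From mathcomp Require Import all_classical all_reals all_analysis.
From mathcomp Require Import Rstruct Rstruct_topology.
From Stdlib Require Import Reals Lra.
From Coquelicot Require Import Coquelicot.

Open Scope R_scope.

(* Vanishing of the bracket splits by degree in (p1, p2). The cubic part makes
   a0 - a2 and 2 a1 a harmonic conjugate pair on the torus, hence constant, and a
   rotation gives a1 = 0, a0 - a2 = k. If k = 0, the linear part (b0, b1)
   satisfies the Cauchy-Riemann equations, so it is constant and can be rotated to
   the p1-axis. If k <> 0, then (b0)_x = (b1)_y and Om = - ((b0)_y + (b1)_x) / (2 k);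
   the compatibility condition of (c0)_x = Om b1, (c0)_y = - Om b0 turns out to say
   that b0 b1 is harmonic, so b0 b1 = m is constant. If m <> 0, b0 solves a Burgers
   equation, whose only global periodic solutions are constants, so Om = 0; hence
   m = 0, and this forces b0 = 0 or b1 = 0. After a quarter turn b1 = 0; then Lam
   depends on y only and F2 = al H + k F1^2 + const with u = b0 / (2 k). *)

(** * Smooth functions of two variables *)

(** The analytic core is that a harmonic function on the torus is constant. This is a strong maximum
    principle: a maximum exists by compactness of a period cell, and subtracting a small multiple of
    a function that is superharmonic outside a small disc shows that the maximal value is approached
    inside that disc, wherever it is placed. The barrier is not periodic, so its growth at infinity
    is needed to keep the perturbed maximum in a bounded region. Smooth functions have no unique
    continuation, so b0 b1 = 0 does not by itself kill one factor; the relation (b0)_x = (b1)_y is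
    what makes b0^2 independent of x and b1^2 independent of y. Similarly, Burgers' equation is not
    solved along characteristics; it is tested at the extrema of (b0)_y. Rotations move the lattice,
    so the facts about the flow are stated for an arbitrary lattice basis, and [normal_form] carries
    an angle of its own so that successive rotations can be undone one at a time. *)

Definition diff_once (f : R -> R -> R) : Prop :=
  forall x y, continuity_2d_pt f x y /\ ex_derive (fun t => f t y) x /\
    ex_derive (fun t => f x t) y.

Definition Cn (n : nat) (f : R -> R -> R) : Prop :=
  forall x y, ex_diff_n f n x y.

(** Moves the quantifier over points inside, so that an induction on [n] can pass to [D1 f] and
    [D2 f] as functions and rewrite them by calculus rules. *)
Lemma CnS n f : Cn n.+1 f <-> diff_once f /\ Cn n (D1 f) /\ Cn n (D2 f).
Proof.
split=> [h | [h [h1 h2]] x y] /=.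
  split=> [x y|]; first by have [? [? [? _]]] := h x y.
  by split=> x y; have [_ [_ [_ []]]] := h x y.
by have [? [? ?]] := h x y; split; [|split; [|split; [|split; [apply: h1|apply: h2]]]].
Qed.

Lemma Cn_le n f : Cn n.+1 f -> Cn n f.
Proof.
elim: n f => [|n IH] f /CnS [h [h1 h2]].
  by move=> x y; split=> //; case: (h x y).
by apply/CnS; split=> //; split; apply: IH.
Qed.

Lemma smooth2_once f : smooth2 f -> diff_once f.
Proof. by move=> h; have /CnS [] : Cn 1 f by apply: h. Qed.

Lemma smooth2_D1 f : smooth2 f -> smooth2 (D1 f).
Proof. by move=> h n; have /CnS [_ []] : Cn n.+1 f by apply: h. Qed.

Lemma smooth2_D2 f : smooth2 f -> smooth2 (D2 f).
Proof. by move=> h n; have /CnS [_ []] : Cn n.+1 f by apply: h. Qed.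

Lemma smooth2_cont f : smooth2 f -> forall x y, continuity_2d_pt f x y.
Proof. by move=> /smooth2_once h x y; case: (h x y). Qed.

Lemma diff_once_is_derive1 f x y :
  diff_once f -> is_derive (fun t => f t y) x (D1 f x y).
Proof. by move=> h; apply: Derive_correct; case: (h x y) => _ []. Qed.

Lemma diff_once_is_derive2 f x y :
  diff_once f -> is_derive (fun t => f x t) y (D2 f x y).
Proof. by move=> h; apply: Derive_correct; case: (h x y) => _ []. Qed.

Lemma smooth2_is_derive1 f x y :
  smooth2 f -> is_derive (fun t => f t y) x (D1 f x y).
Proof. by move=> /smooth2_once; apply: diff_once_is_derive1. Qed.

Lemma smooth2_is_derive2 f x y :
  smooth2 f -> is_derive (fun t => f x t) y (D2 f x y).
Proof. by move=> /smooth2_once; apply: diff_once_is_derive2. Qed.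

Lemma D1_eq f f' :
  (forall x y, is_derive (fun t => f t y) x (f' x y)) -> D1 f = f'.
Proof. by move=> h; apply/funext=> x; apply/funext=> y; apply: is_derive_unique. Qed.

Lemma D2_eq f f' :
  (forall x y, is_derive (fun t => f x t) y (f' x y)) -> D2 f = f'.
Proof. by move=> h; apply/funext=> x; apply/funext=> y; apply: is_derive_unique. Qed.

Lemma Cn_const n c : Cn n (fun _ _ => c).
Proof.
elim: n c => [|n IH] c.
  by move=> x y; split=> //; apply: continuity_2d_pt_const.
have h1 : D1 (fun _ _ => c) = fun _ _ => 0.
  by apply: D1_eq => x y; auto_derive.
have h2 : D2 (fun _ _ => c) = fun _ _ => 0.
  by apply: D2_eq => x y; auto_derive.
apply/CnS; rewrite h1 h2; split; last by split; apply: IH.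
move=> x y; split; first exact: continuity_2d_pt_const.
by split; apply: ex_derive_const.
Qed.

Lemma smooth2_const c : smooth2 (fun _ _ => c).
Proof. by move=> n; apply: Cn_const. Qed.

Lemma smooth2_fst : smooth2 (fun x _ => x).
Proof.
have h1 : D1 (fun x _ => x) = fun _ _ => 1.
  by apply: D1_eq => x y; auto_derive.
have h2 : D2 (fun x _ => x) = fun _ _ => 0.
  by apply: D2_eq => x y; auto_derive.
case=> [|n] x y; first by split=> //; apply: continuity_2d_pt_id1.
move: x y; apply/CnS; rewrite h1 h2; split; last by split; apply: Cn_const.
move=> x y; split; first exact: continuity_2d_pt_id1.
by split; [apply: ex_derive_id | apply: ex_derive_const].
Qed.

Lemma smooth2_snd : smooth2 (fun _ y => y).
Proof.
have h1 : D1 (fun _ y => y) = fun _ _ => 0.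
  by apply: D1_eq => x y; auto_derive.
have h2 : D2 (fun _ y => y) = fun _ _ => 1.
  by apply: D2_eq => x y; auto_derive.
case=> [|n] x y; first by split=> //; apply: continuity_2d_pt_id2.
move: x y; apply/CnS; rewrite h1 h2; split; last by split; apply: Cn_const.
move=> x y; split; first exact: continuity_2d_pt_id2.
by split; [apply: ex_derive_const | apply: ex_derive_id].
Qed.

Lemma D1_plus f g : diff_once f -> diff_once g ->
  D1 (fun x y => f x y + g x y) = fun x y => D1 f x y + D1 g x y.
Proof.
by move=> hf hg; apply: D1_eq => x y; apply: is_derive_plus; apply: diff_once_is_derive1.
Qed.

Lemma D2_plus f g : diff_once f -> diff_once g ->
  D2 (fun x y => f x y + g x y) = fun x y => D2 f x y + D2 g x y.
Proof.
by move=> hf hg; apply: D2_eq => x y; apply: is_derive_plus; apply: diff_once_is_derive2.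
Qed.

Lemma D1_mult f g : diff_once f -> diff_once g ->
  D1 (fun x y => f x y * g x y) =
  fun x y => D1 f x y * g x y + f x y * D1 g x y.
Proof.
move=> hf hg; apply: D1_eq => x y.
apply: (is_derive_mult (fun t => f t y) (fun t => g t y)); last exact: Rmult_comm.
  exact: diff_once_is_derive1.
exact: diff_once_is_derive1.
Qed.

Lemma D2_mult f g : diff_once f -> diff_once g ->
  D2 (fun x y => f x y * g x y) =
  fun x y => D2 f x y * g x y + f x y * D2 g x y.
Proof.
move=> hf hg; apply: D2_eq => x y.
apply: (is_derive_mult (fun t => f x t) (fun t => g x t)); last exact: Rmult_comm.
  exact: diff_once_is_derive2.
exact: diff_once_is_derive2.
Qed.

Lemma Cn_plus n f g : Cn n f -> Cn n g -> Cn n (fun x y => f x y + g x y).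
Proof.
elim: n f g => [|n IH] f g.
  move=> hf hg x y; split=> //.
  by apply: continuity_2d_pt_plus; [case: (hf x y) | case: (hg x y)].
move=> /CnS [hf [f1 f2]] /CnS [hg [g1 g2]]; apply/CnS; split=> [x y|].
  have [? [? ?]] := hf x y; have [? [? ?]] := hg x y.
  by split; [apply: continuity_2d_pt_plus | split; apply: ex_derive_plus].
by rewrite D1_plus ?D2_plus //; split; apply: IH.
Qed.

Lemma Cn_mult n f g : Cn n f -> Cn n g -> Cn n (fun x y => f x y * g x y).
Proof.
elim: n f g => [|n IH] f g.
  move=> hf hg x y; split=> //.
  by apply: continuity_2d_pt_mult; [case: (hf x y) | case: (hg x y)].
move=> hf' hg'; move: (hf') (hg').
move=> /CnS [hf [f1 f2]] /CnS [hg [g1 g2]]; apply/CnS; split=> [x y|].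
  have [? [? ?]] := hf x y; have [? [? ?]] := hg x y.
  by split; [apply: continuity_2d_pt_mult | split; apply: ex_derive_mult].
by rewrite D1_mult ?D2_mult //; split; apply: Cn_plus; apply: IH => //; apply: Cn_le.
Qed.

Lemma smooth2_plus f g :
  smooth2 f -> smooth2 g -> smooth2 (fun x y => f x y + g x y).
Proof. by move=> hf hg n; apply: Cn_plus. Qed.

Lemma smooth2_mult f g :
  smooth2 f -> smooth2 g -> smooth2 (fun x y => f x y * g x y).
Proof. by move=> hf hg n; apply: Cn_mult. Qed.

Lemma smooth2_scal c f : smooth2 f -> smooth2 (fun x y => c * f x y).
Proof. exact/smooth2_mult/smooth2_const. Qed.

Lemma smooth2_lin a b : smooth2 (fun x y => a * x + b * y).
Proof.
apply: smooth2_plus; apply: smooth2_scal; [exact: smooth2_fst | exact: smooth2_snd].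
Qed.

Lemma D2D1 f : smooth2 f -> D2 (D1 f) = D1 (D2 f).
Proof.
move=> hf; apply/funext=> x; apply/funext=> y; symmetry; apply: Schwarz.
- exists (mkposreal 1 Rlt_0_1) => u v _ _.
  have [_ [? ?]] := smooth2_once _ hf u v.
  have [_ [? _]] := smooth2_once _ (smooth2_D2 _ hf) u v.
  by have [_ [_ ?]] := smooth2_once _ (smooth2_D1 _ hf) u v.
- exact/smooth2_cont/smooth2_D1/smooth2_D2.
- exact/smooth2_cont/smooth2_D2/smooth2_D1.
Qed.

Lemma smooth2_differentiable f x y : smooth2 f ->
  differentiable_pt_lim f x y (D1 f x y) (D2 f x y).
Proof.
move=> hf; apply/filterdiff_differentiable_pt_lim.
apply: (is_derive_filterdiff f x y (D1 f)).
- by apply: filter_forall => -[u v]; apply: smooth2_is_derive1.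
- exact: smooth2_is_derive2.
- exact/continuity_2d_pt_filterlim/smooth2_cont/smooth2_D1.
Qed.

Lemma is_derive_smooth2_comp f a b x a' b' : smooth2 f ->
  is_derive a x a' -> is_derive b x b' ->
  is_derive (fun t => f (a t) (b t)) x
    (D1 f (a x) (b x) * a' + D2 f (a x) (b x) * b').
Proof.
move=> hf ha hb; apply/is_derive_Reals; apply: derivable_pt_lim_comp_2d.
- exact: smooth2_differentiable.
- exact/is_derive_Reals.
- exact/is_derive_Reals.
Qed.

(** * Linear changes of variables *)

Section LinearChange.
Variables a b c d : R.

Let pull (f : R -> R -> R) x y := f (a * x + b * y) (c * x + d * y).

Lemma D1_pull f : smooth2 f ->
  D1 (pull f) = fun x y => a * pull (D1 f) x y + c * pull (D2 f) x y.
Proof.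
move=> hf; apply: D1_eq => x y.
rewrite (Rmult_comm a) (Rmult_comm c).
apply: (is_derive_smooth2_comp f (fun t => a * t + b * y) (fun t => c * t + d * y)) => //.
  by auto_derive => //; lra.
by auto_derive => //; lra.
Qed.

Lemma D2_pull f : smooth2 f ->
  D2 (pull f) = fun x y => b * pull (D1 f) x y + d * pull (D2 f) x y.
Proof.
move=> hf; apply: D2_eq => x y.
rewrite (Rmult_comm b) (Rmult_comm d).
apply: (is_derive_smooth2_comp f (fun t => a * x + b * t) (fun t => c * x + d * t)) => //.
  by auto_derive => //; lra.
by auto_derive => //; lra.
Qed.

Lemma smooth2_pull f : smooth2 f -> smooth2 (pull f).
Proof.
have cont g : smooth2 g -> forall x y, continuity_2d_pt (pull g) x y.
  move=> hg x y; apply/differentiable_continuity_pt; do 2 eexists.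
  apply: (differentiable_pt_lim_comp g); first exact: smooth2_differentiable.
    exact/smooth2_differentiable/smooth2_lin.
  exact/smooth2_differentiable/smooth2_lin.
move=> hf n; move: f hf; rewrite -/(Cn n _).
elim: n => [|n IH] f hf; first by move=> x y; split=> //; apply: cont.
apply/CnS; split=> [x y|].
  split; [exact: cont | split; eexists].
    apply: (is_derive_smooth2_comp f (fun t => a * t + b * y) (fun t => c * t + d * y)) => //.
      by auto_derive.
    by auto_derive.
  apply: (is_derive_smooth2_comp f (fun t => a * x + b * t) (fun t => c * x + d * t)) => //.
    by auto_derive.
  by auto_derive.
have h1 := IH _ (smooth2_D1 _ hf); have h2 := IH _ (smooth2_D2 _ hf).
rewrite D1_pull ?D2_pull //.
by split; apply: Cn_plus; apply: Cn_mult => //; apply: Cn_const.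
Qed.

End LinearChange.

(** * Maximum principle on the torus *)

Lemma abs_lt_sqr a r : 0 <= r -> a ^ 2 < r ^ 2 -> Rabs a < r.
Proof. by move=> r0 h; apply/Rabs_lt_between; nra. Qed.

Lemma abs_le_sqr a r : 0 <= r -> a ^ 2 <= r ^ 2 -> Rabs a <= r.
Proof. by move=> r0 h; apply/Rabs_le_between; nra. Qed.

(** Each point receives a radius [delta] on which [f] varies by less than 1 and which is at most 1 /
    (1 + |f|). A uniform lower bound on the radii of the selected nodes therefore bounds |f| at the
    nodes, and so [f] everywhere. *)
Lemma bounded_above_2d f a b c d :
  (forall x y, a <= x <= b -> c <= y <= d -> continuity_2d_pt f x y) ->
  exists M, forall x y, a <= x <= b -> c <= y <= d -> f x y <= M.
Proof.
move=> hf.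
have ex_delta (z : R * R) : exists e : posreal,
    a <= z.1 <= b -> c <= z.2 <= d ->
    (forall u v, Rabs (u - z.1) < e -> Rabs (v - z.2) < e ->
       Rabs (f u v - f z.1 z.2) < 1) /\ e <= / (1 + Rabs (f z.1 z.2)).
  case: (pselect (a <= z.1 <= b /\ c <= z.2 <= d)) => [[h1 h2]|h]; last first.
    by exists (mkposreal 1 Rlt_0_1) => h1 h2; case: h.
  have [e he] := hf _ _ h1 h2 (mkposreal 1 Rlt_0_1).
  have hp : 0 < / (1 + Rabs (f z.1 z.2)).
    by apply: Rinv_0_lt_compat; have := Rabs_pos (f z.1 z.2); lra.
  exists (mkposreal _ (Rmin_stable_in_posreal e (mkposreal _ hp))) => _ _ /=.
  split; last exact: Rmin_r.
  move=> u v hu hv; apply: he.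
    exact: Rlt_le_trans hu (Rmin_l _ _).
  exact: Rlt_le_trans hv (Rmin_l _ _).
have [delta hdelta] := boolp.choice ex_delta.
have [e he] := compactness_value_2d a b c d (fun u v => delta (u, v)).
(* [compactness_value_2d] provides the node only under a double negation, hence the argument by
   contradiction on a decidable goal. *)
exists (1 + / e) => x y hx hy; case: (Rle_dec (f x y) (1 + / e)) => // hn.
exfalso; apply: (he x y hx hy) => -[u [v [hu [hv [h1 [h2 h3]]]]]]; apply: hn.
have [/= near small] := hdelta (u, v) hu hv.
have := near x y h1 h2.
have pos := Rabs_pos (f u v).
have : 1 + Rabs (f u v) <= / e.
  rewrite -(Rinv_inv (1 + Rabs (f u v))).
  by apply: Rinv_le_contravar; [exact: cond_pos | lra].
have := Rle_abs (f x y - f u v); have := Rle_abs (f u v); lra.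
Qed.

Lemma max_attained_2d f a b c d : a <= b -> c <= d ->
  (forall x y, continuity_2d_pt f x y) ->
  exists p q, a <= p <= b /\ c <= q <= d /\
    forall x y, a <= x <= b -> c <= y <= d -> f x y <= f p q.
Proof.
move=> hab hcd hf.
have [M hM] := bounded_above_2d f a b c d (fun x y _ _ => hf x y).
pose E r := exists x y, a <= x <= b /\ c <= y <= d /\ r = f x y.
have [S [ub lub]] : {S | is_lub E S}.
  apply: completeness; first by exists M => r [x [y [hx [hy ->]]]]; apply: hM.
  by exists (f a c), a, c; split; [|split] => //; lra.
case: (pselect (exists p q, a <= p <= b /\ c <= q <= d /\ f p q = S)).
  move=> [p [q [hp [hq e]]]]; exists p, q; do 2 split=> //.
  by move=> x y hx hy; rewrite e; apply: ub; exists x, y.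
move=> no.
have lt x y : a <= x <= b -> c <= y <= d -> f x y < S.
  move=> hx hy; have : f x y <= S by apply: ub; exists x, y.
  case=> // e; case: no; by exists x, y.
(* If the supremum S were not attained, 1 / (S - f) would be unbounded. *)
have [N hN] : exists N, forall x y, a <= x <= b -> c <= y <= d ->
    / (S - f x y) <= N.
  apply: bounded_above_2d => x y hx hy; apply: continuity_2d_pt_inv.
    by apply: continuity_2d_pt_minus => //; apply: continuity_2d_pt_const.
  by have := lt x y hx hy; lra.
have N0 : 0 < N.
  apply: Rlt_le_trans (hN a c _ _); try lra.
  by apply: Rinv_0_lt_compat; have := lt a c; lra.
suff : S <= S - / N by have := Rinv_0_lt_compat _ N0; lra.
apply: lub => r [x [y [hx [hy ->]]]].
have h := lt x y hx hy.
suff : / N <= S - f x y by lra.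
rewrite -(Rinv_inv (S - f x y)); apply: Rinv_le_contravar; last exact: hN.
by apply: Rinv_0_lt_compat; lra.
Qed.

Lemma periodic_Z g (x y w z : R) (n : Z) :
  (forall x y : R, g (x + w) (y + z) = g x y) ->
  g (x + IZR n * w) (y + IZR n * z) = g x y :> R.
Proof.
move=> h.
have nat_case (k : nat) x' y' : g (x' + INR k * w) (y' + INR k * z) = g x' y'.
  elim: k => [|k IH]; first by congr g; rewrite /=; lra.
  by rewrite S_INR -[RHS]IH -[RHS]h; congr g; lra.
case: n => [|k|k]; rewrite /IZR -?INR_IPR //; first by congr g; lra.
by rewrite -(nat_case (Pos.to_nat k)); congr g; lra.
Qed.

Definition doubly_periodic (w1 w2 : R * R) (g : R -> R -> R) : Prop :=
  forall x y, g (x + fst w1) (y + snd w1) = g x y /\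
    g (x + fst w2) (y + snd w2) = g x y.

(** Subtracting the integer parts of the lattice coordinates moves any point into the fundamental
    parallelogram, which lies in the square of half-side [r]; a maximum on that square is global. *)
Lemma periodic_max w1 w2 g : is_basis w1 w2 -> doubly_periodic w1 w2 g ->
  (forall x y, continuity_2d_pt g x y) ->
  exists p q, forall x y, g x y <= g p q.
Proof.
case: w1 w2 => [a b] [c d]; rewrite /is_basis /= => hD hp hc.
pose r := Rabs a + Rabs b + Rabs c + Rabs d.
have r0 : 0 <= r.
  by have := Rabs_pos a; have := Rabs_pos b; have := Rabs_pos c;
     have := Rabs_pos d; rewrite /r; lra.
have [p [q [_ [_ h]]]] :=
  max_attained_2d g (- r) r (- r) r ltac:(lra) ltac:(lra) hc.
exists p, q => x y.
(* Coordinates of (x, y) in the lattice basis, by Cramer's rule. *)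
pose s := (x * d - y * c) / (a * d - b * c).
pose t := (a * y - b * x) / (a * d - b * c).
have ex : x = s * a + t * c by rewrite /s /t; field.
have ey : y = s * b + t * d by rewrite /s /t; field.
have [s0 s1] := base_Int_part s; have [t0 t1] := base_Int_part t.
pose s' := s - IZR (Int_part s); pose t' := t - IZR (Int_part t).
have -> : g x y = g (s' * a + t' * c) (s' * b + t' * d).
  rewrite -(periodic_Z g _ _ a b (- Int_part s)%Z); last by move=> u v; case: (hp u v).
  rewrite -(periodic_Z g _ _ c d (- Int_part t)%Z); last by move=> u v; case: (hp u v).
  by congr g; rewrite /s' /t' !opp_IZR; lra.
have bnd k l : Rabs k + Rabs l <= r -> - r <= s' * k + t' * l <= r.
  move=> hkl; apply/Rabs_le_between; apply: Rle_trans hkl.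
  apply: Rle_trans (Rabs_triang _ _) _; rewrite !Rabs_mult.
  have ? : Rabs s' <= 1 by apply/Rabs_le_between; rewrite /s'; lra.
  have ? : Rabs t' <= 1 by apply/Rabs_le_between; rewrite /t'; lra.
  by have := Rabs_pos k; have := Rabs_pos l; nra.
by apply: h; apply: bnd; have := Rabs_pos a; have := Rabs_pos b;
  have := Rabs_pos c; have := Rabs_pos d; rewrite /r; lra.
Qed.

Lemma derive_at_max (f : R -> R) (x l : R) : is_derive f x l -> (forall t, f t <= f x) -> l = 0.
Proof.
move=> /is_derive_Reals hd hm.
have pr : derivable_pt f x by exists l.
have := deriv_maximum f (x - 1) (x + 1) x pr ltac:(lra) ltac:(lra)
  (fun t _ _ => hm t).
by move=> <-; apply/esym/derive_pt_eq.
Qed.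

(** If [l] were positive, [f'] would be positive just to the right of its zero [x], and the mean
    value theorem would make [f] exceed its maximum there. *)
Lemma derive2_at_max (f f' : R -> R) (x l : R) : (forall t, is_derive f t (f' t)) ->
  is_derive f' x l -> (forall t, f t <= f x) -> l <= 0.
Proof.
move=> hf hf' hm; case: (Rle_dec l 0) => // hl.
have f'0 : f' x = 0 by apply: derive_at_max hm.
have /is_derive_Reals hd := hf'.
have [d hdelta] := hd (l / 2) ltac:(lra).
have dpos := cond_pos d.
have pos t : x < t < x + d -> 0 < f' t.
  move=> ht; have := hdelta (t - x) ltac:(lra).
  rewrite Rabs_pos_eq; last lra.
  rewrite f'0 (_ : x + (t - x) = t); last ring.
  move=> /(_ ltac:(lra)) /Rabs_lt_between [h _].
  have e : f' t = (f' t - 0) / (t - x) * (t - x) by field; lra.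
  by rewrite e; apply: Rmult_lt_0_compat; lra.
have [c [hc]] : exists c, x < c < x + d / 2 /\
    f (x + d / 2) - f x = f' c * (x + d / 2 - x).
  have [||c] := MVT_cor2 f f' x (x + d / 2).
  - by lra.
  - by move=> t _; apply/is_derive_Reals.
  by move=> [e ht]; exists c.
have := pos c ltac:(lra); have := hm (x + d / 2); nra.
Qed.

Section Barrier.
Variables (x0 y0 d : R).
Hypothesis d0 : 0 < d.

(* A smooth function tending to infinity whose Laplacian is negative away
   from the centre (x0, y0). *)
Let w x y := (x - x0) ^ 2 + (y - y0) ^ 2 + d.
Let barrier x y := ln (w x y) - / w x y.

Let w0 x y : 0 < w x y.
Proof.
by rewrite /w; have := pow2_ge_0 (x - x0); have := pow2_ge_0 (y - y0); lra.
Qed.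

Let barrier_cont x y : continuity_2d_pt barrier x y.
Proof.
have cw : continuity_2d_pt w x y.
  apply: smooth2_cont; apply: smooth2_plus; last exact: smooth2_const.
  have := smooth2_plus _ _ smooth2_fst (smooth2_const (- x0)).
  have := smooth2_plus _ _ smooth2_snd (smooth2_const (- y0)).
  move=> h1 h2; apply: smooth2_plus; rewrite /pow.
    by do 2 (apply: smooth2_mult => //); apply: smooth2_const.
  by do 2 (apply: smooth2_mult => //); apply: smooth2_const.
apply: continuity_2d_pt_minus; last first.
  by apply: continuity_2d_pt_inv => //; have := w0 x y; lra.
apply: continuity_1d_2d_pt_comp => //.
apply: derivable_continuous_pt; exists (/ w x y).
exact: derivable_pt_lim_ln.
Qed.

(** The coordinate [u] of the centre and the value [v] of [w] are parameters, so that one formula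
    serves both partial derivatives. *)
Let dbarrier u v x := 2 * (x - u) * (/ v + / v ^ 2).

Let barrier_d1 x y :
  is_derive (fun t => barrier t y) x (dbarrier x0 (w x y) x).
Proof.
rewrite /barrier /dbarrier /w; have := w0 x y; rewrite /w => ?.
by auto_derive; [split; lra | field; lra].
Qed.

Let barrier_d2 x y :
  is_derive (fun t => barrier x t) y (dbarrier y0 (w x y) y).
Proof.
rewrite /barrier /dbarrier /w; have := w0 x y; rewrite /w => ?.
by auto_derive; [split; lra | field; lra].
Qed.

Let ddbarrier u v x :=
  2 * (/ v + / v ^ 2) - 4 * (x - u) ^ 2 * (/ v ^ 2 + 2 / v ^ 3).

Let barrier_d11 x y :
  is_derive (fun t => dbarrier x0 (w t y) t) x (ddbarrier x0 (w x y) x).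
Proof.
rewrite /dbarrier /ddbarrier /w; have := w0 x y; rewrite /w => ?.
by auto_derive; [repeat split; nra | field; lra].
Qed.

Let barrier_d22 x y :
  is_derive (fun t => dbarrier y0 (w x t) t) y (ddbarrier y0 (w x y) y).
Proof.
rewrite /dbarrier /ddbarrier /w; have := w0 x y; rewrite /w => ?.
by auto_derive; [repeat split; nra | field; lra].
Qed.

(** The shift by [d] removes the singularity of the logarithm at the centre, at the price of a
    positive Laplacian 4 d / w^2 for ln w. The term - 1 / w contributes - 4 / w^2 to leading order,
    which wins for d < 1 once w is large compared with d. *)
Let barrier_neg x y : 2 * d < w x y * (1 - d) ->
  ddbarrier x0 (w x y) x + ddbarrier y0 (w x y) y < 0.
Proof.
move=> h; have p := w0 x y.
have -> : ddbarrier x0 (w x y) x + ddbarrier y0 (w x y) y =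
    4 * (2 * d - w x y * (1 - d)) / w x y ^ 3.
  rewrite /ddbarrier; set v := w x y.
  have -> : (x - x0) ^ 2 = v - d - (y - y0) ^ 2 by rewrite /v /w; ring.
  by field; rewrite -/v in p; lra.
apply: Rdiv_neg_pos; first lra.
exact: pow_lt.
Qed.

(** If g p q > eta, perturb to v = g - e barrier with e small and take a global maximum of v. Inside
    the disc v is too small for that, because g <= eta there; outside it the Laplacian of v is
    positive, against the second derivative test. *)
Lemma harmonic_near_max g p q : smooth2 g ->
  (forall x y, D1 (D1 g) x y + D2 (D2 g) x y = 0) ->
  (forall x y, g x y <= g p q) ->
  forall eta, (forall x y, w x y * (1 - d) <= 2 * d -> g x y <= eta) ->
  g p q <= eta.
Proof.
move=> hg harm hmax eta heta; case: (Rle_dec (g p q) eta) => // hn; exfalso.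
(* The barrier is at least ln d - 1 / d, its value at the centre. Thus [gap] strictly exceeds the
   drop of the barrier from (p, q) to any point, and [e * gap] is exactly the excess of g p q over
   [eta]. *)
pose gap := Rabs (barrier p q) + Rabs (ln d - / d) + 1.
have gap0 : 0 < gap.
  by have := Rabs_pos (barrier p q); have := Rabs_pos (ln d - / d); rewrite /gap; lra.
pose e := (g p q - eta) / gap.
have e0 : 0 < e by apply: Rdiv_lt_0_compat; lra.
pose v x y := g x y - e * barrier x y.
(* The exponential makes the barrier at least [barrier p q] wherever w >= r^2, and the other two
   terms put (p, q) in the square. Since r >= 1, r^2 dominates the exponential too. *)
pose r := exp (Rabs (barrier p q) + / d) + Rabs (p - x0) + Rabs (q - y0).
have r1 : 1 <= exp (Rabs (barrier p q) + / d).
  have := exp_ineq1_le (Rabs (barrier p q) + / d).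
  by have := Rabs_pos (barrier p q); have := Rinv_0_lt_compat _ d0; lra.
have vc x y : continuity_2d_pt v x y.
  apply: continuity_2d_pt_minus; first exact: smooth2_cont.
  by apply: continuity_2d_pt_mult => //; apply: continuity_2d_pt_const.
have hr := conj (Rabs_pos (p - x0)) (Rabs_pos (q - y0)).
have [x [y [_ [_ hxy]]]] := max_attained_2d v (x0 - r) (x0 + r) (y0 - r) (y0 + r)
  ltac:(rewrite /r; lra) ltac:(rewrite /r; lra) vc.
have vpq : v p q <= v x y.
  have := Rle_abs (p - x0); have := Rle_abs (q - y0).
  have := Rle_abs (- (p - x0)); have := Rle_abs (- (q - y0)); rewrite !Rabs_Ropp.
  by move=> *; apply: hxy; rewrite /r; lra.
have far s t : r ^ 2 <= w s t -> v s t <= v x y.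
  move=> h; apply: Rle_trans vpq; rewrite /v.
  suff : barrier p q <= barrier s t by have := hmax s t; nra.
  apply: Rle_trans (Rle_abs _) _.
  have : / w s t <= / d.
    apply: Rinv_le_contravar => //.
    by rewrite /w; have := pow2_ge_0 (s - x0); have := pow2_ge_0 (t - y0); lra.
  suff : Rabs (barrier p q) + / d <= ln (w s t) by rewrite /(barrier s t); lra.
  rewrite -[X in X <= _]ln_exp; apply: ln_le; first exact: exp_pos.
  by apply: Rle_trans h; rewrite /r in hr *; nra.
have vmax s t : v s t <= v x y.
  case: (Rle_dec (r ^ 2) (w s t)) => [|h]; first exact: far.
  have r0 : 0 <= r by rewrite /r; lra.
  have : Rabs (s - x0) <= r.
    by apply: abs_le_sqr => //; have := pow2_ge_0 (t - y0); rewrite /w in h; lra.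
  have : Rabs (t - y0) <= r.
    by apply: abs_le_sqr => //; have := pow2_ge_0 (s - x0); rewrite /w in h; lra.
  move=> /Rabs_le_between ? /Rabs_le_between ?.
  by apply: hxy; lra.
have := heta x y.
case: (Rle_dec (w x y * (1 - d)) (2 * d)) => [h /(_ h) near|/Rnot_le_lt h _].
  have : ln d - / d <= barrier x y.
    have wd : d <= w x y.
      by rewrite /w; have := pow2_ge_0 (x - x0); have := pow2_ge_0 (y - y0); lra.
    have := ln_le _ _ d0 wd; have := Rinv_le_contravar _ _ d0 wd.
    by rewrite /barrier; lra.
  have := Rle_abs (barrier p q); have := Rle_abs (- (ln d - / d)); rewrite Rabs_Ropp.
  have : e * gap = g p q - eta by rewrite /e; field; lra.
  by rewrite /v /gap in vpq *; nra.
have h1 : D1 (D1 g) x y - e * ddbarrier x0 (w x y) x <= 0.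
  apply: (derive2_at_max (fun t => v t y)
    (fun t => D1 g t y - e * dbarrier x0 (w t y) t) x) => [t||t]; last exact: vmax.
    apply: is_derive_minus; first exact: smooth2_is_derive1.
    exact/is_derive_scal/barrier_d1.
  apply: is_derive_minus; first exact/smooth2_is_derive1/smooth2_D1.
  exact/is_derive_scal/barrier_d11.
have h2 : D2 (D2 g) x y - e * ddbarrier y0 (w x y) y <= 0.
  apply: (derive2_at_max (fun t => v x t)
    (fun t => D2 g x t - e * dbarrier y0 (w x t) t) y) => [t||t]; last exact: vmax.
    apply: is_derive_minus; first exact: smooth2_is_derive2.
    exact/is_derive_scal/barrier_d2.
  apply: is_derive_minus; first exact/smooth2_is_derive2/smooth2_D2.
  exact/is_derive_scal/barrier_d22.
have := barrier_neg x y h; have := harm x y; nra.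
Qed.

End Barrier.

(** The barrier is centred at the arbitrary point (x, y), not at the maximum: the maximal value is
    then bounded by the values of [g] near (x, y), and continuity there finishes. *)
Lemma harmonic_max_const g p q : smooth2 g ->
  (forall x y, D1 (D1 g) x y + D2 (D2 g) x y = 0) ->
  (forall x y, g x y <= g p q) -> forall x y, g x y = g p q.
Proof.
move=> hg harm hmax x y; apply: Rle_antisym; first exact: hmax.
apply: le_epsilon => eps eps0.
have [r hr] := smooth2_cont _ hg x y (mkposreal _ eps0).
have r0 := cond_pos r.
(* With d <= 1/2, the region w (1 - d) <= 2 d has w <= 4 d, so its squared radius is at most 3 d <
   r^2. *)
pose d := Rmin (1 / 2) (r ^ 2 / 4).
have d0 : 0 < d by apply: Rmin_pos; nra.
have d1 : d <= 1 / 2 by apply: Rmin_l.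
have d2 : d <= r ^ 2 / 4 by apply: Rmin_r.
apply: (harmonic_near_max x y d d0 g p q hg harm hmax) => s t h.
have h' : (s - x) ^ 2 + (t - y) ^ 2 < r ^ 2.
  by have := pow2_ge_0 (s - x); have := pow2_ge_0 (t - y); nra.
have hs : Rabs (s - x) < r.
  by apply: abs_lt_sqr; [lra | have := pow2_ge_0 (t - y); lra].
have ht : Rabs (t - y) < r.
  by apply: abs_lt_sqr; [lra | have := pow2_ge_0 (s - x); lra].
by have /= := hr s t hs ht; move=> /Rabs_lt_between; lra.
Qed.

Lemma harmonic_periodic_const w1 w2 g : is_basis w1 w2 -> torus_fun w1 w2 g ->
  (forall x y, D1 (D1 g) x y + D2 (D2 g) x y = 0) ->
  exists k, forall x y, g x y = k.
Proof.
move=> hb [hg hp] harm.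
have [p [q h]] := periodic_max w1 w2 g hb hp (smooth2_cont _ hg).
by exists (g p q); apply: harmonic_max_const.
Qed.

(** * The linear part of the integral *)

Lemma D1_scal k f : diff_once f ->
  D1 (fun x y => k * f x y) = fun x y => k * D1 f x y.
Proof.
by move=> hf; apply: D1_eq => x y; apply: is_derive_scal; apply: diff_once_is_derive1.
Qed.

Lemma D2_scal k f : diff_once f ->
  D2 (fun x y => k * f x y) = fun x y => k * D2 f x y.
Proof.
by move=> hf; apply: D2_eq => x y; apply: is_derive_scal; apply: diff_once_is_derive2.
Qed.

Lemma derive_zero_const (f : R -> R) : (forall t, is_derive f t 0) ->
  forall s t, f s = f t.
Proof.
move=> h; have lt s t : s < t -> f s = f t by apply: eq_is_derive => ? _; apply: h.
move=> s t; case: (Rtotal_order s t) => [|[->|]] // st; first exact: lt.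
by symmetry; apply: lt.
Qed.

Lemma D1_zero_const f : diff_once f -> (forall x y, D1 f x y = 0) ->
  forall x x' y, f x y = f x' y.
Proof.
move=> hf h x x' y; apply: (derive_zero_const (fun t => f t y)) => t.
by rewrite -(h t y); apply: diff_once_is_derive1.
Qed.

Lemma D2_zero_const f : diff_once f -> (forall x y, D2 f x y = 0) ->
  forall x y y', f x y = f x y'.
Proof.
move=> hf h x y y'; apply: (derive_zero_const (fun t => f x t)) => t.
by rewrite -(h x t); apply: diff_once_is_derive2.
Qed.

Section TorusFun.
Variables w1 w2 : R * R.

Lemma torus_fun_plus f g : torus_fun w1 w2 f -> torus_fun w1 w2 g ->
  torus_fun w1 w2 (fun x y => f x y + g x y).
Proof.
move=> [hf pf] [hg pg]; split; first exact: smooth2_plus.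
by move=> x y; have [-> ->] := pf x y; have [-> ->] := pg x y.
Qed.

Lemma torus_fun_mult f g : torus_fun w1 w2 f -> torus_fun w1 w2 g ->
  torus_fun w1 w2 (fun x y => f x y * g x y).
Proof.
move=> [hf pf] [hg pg]; split; first exact: smooth2_mult.
by move=> x y; have [-> ->] := pf x y; have [-> ->] := pg x y.
Qed.

Lemma torus_fun_scal k f : torus_fun w1 w2 f ->
  torus_fun w1 w2 (fun x y => k * f x y).
Proof.
by move=> h; apply: torus_fun_mult => //; split=> //; apply: smooth2_const.
Qed.

Lemma torus_fun_D2 f : torus_fun w1 w2 f -> torus_fun w1 w2 (D2 f).
Proof.
move=> [hf pf]; split; first exact: smooth2_D2.
have shift a b : (forall x y, f (x + a) (y + b) = f x y) ->
    forall x y, D2 f (x + a) (y + b) = D2 f x y.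
  move=> h x y; apply: is_derive_unique.
  apply: (is_derive_ext (fun t => f x (t - b))).
    by move=> t; rewrite -h; congr f; ring.
  rewrite (_ : D2 f x y = D1 f x (y + b - b) * 0 + D2 f x (y + b - b) * 1); last first.
    by rewrite (_ : y + b - b = y); ring.
  apply: (is_derive_smooth2_comp f (fun=> x) (fun t => t - b)) => //.
    by auto_derive.
  by auto_derive => //; ring.
by move=> x y; split; apply: shift => s t; case: (pf s t).
Qed.

(** Both components are harmonic by equality of mixed partials. Used for (a0 - a2, 2 a1), and for
    (b0, b1) when k = 0. *)
Lemma cauchy_riemann_const f g : is_basis w1 w2 ->
  torus_fun w1 w2 f -> torus_fun w1 w2 g ->
  (forall x y, D1 f x y = D2 g x y) -> (forall x y, D2 f x y = - D1 g x y) ->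
  exists k l, forall x y, f x y = k /\ g x y = l.
Proof.
move=> hb hf hg e1 e2; have [sf _] := hf; have [sg _] := hg.
have E1 : D1 f = D2 g by apply/funext=> x; apply/funext=> y.
have E2 : D2 f = fun x y => -1 * D1 g x y.
  by apply/funext=> x; apply/funext=> y; rewrite e2; lra.
have E3 : D1 g = fun x y => -1 * D2 f x y.
  by apply/funext=> x; apply/funext=> y; rewrite e2; lra.
have [k hk] : exists k, forall x y, f x y = k.
  apply: (harmonic_periodic_const w1 w2) => // x y.
  rewrite E1 E2 D2_scal; last exact/smooth2_once/smooth2_D1.
  by rewrite D2D1 //; lra.
have [l hl] : exists l, forall x y, g x y = l.
  apply: (harmonic_periodic_const w1 w2) => // x y.
  rewrite E3 -E1 D1_scal; last exact/smooth2_once/smooth2_D2.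
  by rewrite D2D1 //; lra.
by exists k, l.
Qed.

End TorusFun.

Lemma laplacian_mult f g x y : smooth2 f -> smooth2 g ->
  D1 (D1 (fun x y => f x y * g x y)) x y + D2 (D2 (fun x y => f x y * g x y)) x y =
  (D1 (D1 f) x y + D2 (D2 f) x y) * g x y
  + 2 * (D1 f x y * D1 g x y + D2 f x y * D2 g x y)
  + f x y * (D1 (D1 g) x y + D2 (D2 g) x y).
Proof.
move=> hf hg; have df := smooth2_once _ hf; have dg := smooth2_once _ hg.
have f1 := smooth2_D1 _ hf; have f2 := smooth2_D2 _ hf.
have g1 := smooth2_D1 _ hg; have g2 := smooth2_D2 _ hg.
rewrite D1_mult // D2_mult //.
rewrite D1_plus; try exact/smooth2_once/smooth2_mult.
rewrite D2_plus; try exact/smooth2_once/smooth2_mult.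
rewrite !D1_mult ?D2_mult //; try exact: smooth2_once.
ring.
Qed.

(* The compatibility condition of c_x = Om b1, c_y = - Om b0 is Laplace's
   equation for b0 b1. *)
Lemma linear_part_product_const w1 w2 Om b0 b1 c k :
  is_basis w1 w2 -> smooth2 Om -> torus_fun w1 w2 b0 -> torus_fun w1 w2 b1 ->
  smooth2 c -> k <> 0 ->
  (forall x y, D1 b0 x y = D2 b1 x y) ->
  (forall x y, D2 b0 x y + D1 b1 x y = - 2 * k * Om x y) ->
  (forall x y, D1 c x y = Om x y * b1 x y) ->
  (forall x y, D2 c x y = - Om x y * b0 x y) ->
  exists m, forall x y, b0 x y * b1 x y = m.
Proof.
move=> hb sO t0 t1 sc k0 e1 e2 e3 e4; have [s0 _] := t0; have [s1 _] := t1.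
have o0 := smooth2_once _ s0; have o1 := smooth2_once _ s1; have oO := smooth2_once _ sO.
have E1 : D1 b0 = D2 b1 by apply/funext=> x; apply/funext=> y.
have EO : (fun x y => D2 b0 x y + D1 b1 x y) = fun x y => (- 2 * k) * Om x y.
  by apply/funext=> x; apply/funext=> y; rewrite e2; lra.
have E3 : D1 c = fun x y => Om x y * b1 x y.
  by apply/funext=> x; apply/funext=> y.
have E4 : D2 c = fun x y => -1 * (Om x y * b0 x y).
  by apply/funext=> x; apply/funext=> y; rewrite e4; lra.
apply: (harmonic_periodic_const w1 w2 (fun x y => b0 x y * b1 x y)) => // [|x y].
  exact: torus_fun_mult.
have hc : D2 (D1 c) x y = D1 (D2 c) x y by rewrite D2D1.
rewrite E3 E4 D2_mult // D1_scal ?D1_mult // in hc; last first.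
  exact/smooth2_once/smooth2_mult.
have hO1 : D1 (fun x y => D2 b0 x y + D1 b1 x y) x y = - 2 * k * D1 Om x y.
  by rewrite EO D1_scal.
have hO2 : D2 (fun x y => D2 b0 x y + D1 b1 x y) x y = - 2 * k * D2 Om x y.
  by rewrite EO D2_scal.
have [d02 d11] := conj (smooth2_once _ (smooth2_D2 _ s0)) (smooth2_once _ (smooth2_D1 _ s1)).
rewrite D1_plus // in hO1; rewrite D2_plus // in hO2.
(* The Laplacians of b0 and b1 are - 2 k Om_y and - 2 k Om_x, and the cross term is - 4 k Om (b0)_x.
   The Laplacian of b0 b1 is thus - 2 k ((Om b0)_x + (Om b1)_y), which vanishes by [hc]. *)
have h1 : D1 (D1 b0) x y = D2 (D1 b1) x y by rewrite E1 D2D1.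
have h2 : D2 (D2 b1) x y = D1 (D2 b0) x y by rewrite -E1 D2D1.
rewrite laplacian_mult // h1 h2.
have := e1 x y; have := e2 x y.
move: hc hO1 hO2.
set A := D1 (D2 b0) x y; set B := D2 (D2 b0) x y.
set C := D1 (D1 b1) x y; set D := D2 (D1 b1) x y.
move=> hc hO1 hO2 e2' e1'.
have -> : B = - 2 * k * D2 Om x y - D by lra.
have -> : C = - 2 * k * D1 Om x y - A by lra.
have -> : D2 b0 x y = - 2 * k * Om x y - D1 b1 x y by lra.
rewrite -e1' in hc *.
have : -2 * k * (D2 Om x y * b1 x y + Om x y * D1 b0 x y) =
   2 * k * (D1 Om x y * b0 x y + Om x y * D1 b0 x y) by rewrite hc; ring.
lra.
Qed.


(** With b1 = m / b0, the relation (b0)_x = (b1)_y becomes an equation for b0 alone. Periodicity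
    provides a maximum and a minimum of (b0)_y, and the equation forces both extremal values to be
    zero. *)
Lemma product_nonzero_const w1 w2 b0 b1 m :
  is_basis w1 w2 -> torus_fun w1 w2 b0 -> smooth2 b1 ->
  m <> 0 -> (forall x y, D1 b0 x y = D2 b1 x y) ->
  (forall x y, b0 x y * b1 x y = m) ->
  forall x y, D2 b0 x y = 0 /\ D1 b1 x y = 0.
Proof.
move=> hb t0 s1 m0 e1 em; have [s0 _] := t0.
have o0 := smooth2_once _ s0; have o1 := smooth2_once _ s1.
have Em : (fun x y => b0 x y * b1 x y) = fun _ _ => m.
  by apply/funext=> x; apply/funext=> y.
have m1 x y : D1 b0 x y * b1 x y + b0 x y * D1 b1 x y = 0.
  rewrite -[LHS]/((fun x y => D1 b0 x y * b1 x y + b0 x y * D1 b1 x y) x y).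
  by rewrite -D1_mult // Em; apply: Derive_const.
have m2 x y : D2 b0 x y * b1 x y + b0 x y * D2 b1 x y = 0.
  rewrite -[LHS]/((fun x y => D2 b0 x y * b1 x y + b0 x y * D2 b1 x y) x y).
  by rewrite -D2_mult // Em; apply: Derive_const.
have burgers x y : b0 x y ^ 2 * D1 b0 x y = - m * D2 b0 x y.
  have : b0 x y * (D2 b0 x y * b1 x y + b0 x y * D2 b1 x y) = 0.
    by rewrite m2; ring.
  by rewrite -e1 -(em x y); lra.
pose z := D2 b0.
have sz : smooth2 z by apply: smooth2_D2.
(* Differentiating Burgers' equation gives a Riccati equation for z, which
   forces z = 0 at its critical points, in particular at its extrema. *)
have crit x y : D1 z x y = 0 -> D2 z x y = 0 -> z x y = 0.
  move=> z1 z2.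
  have E : (fun x y => b0 x y * (b0 x y * D1 b0 x y)) = fun x y => - m * z x y.
    by apply/funext=> s; apply/funext=> t; rewrite /z -burgers; ring.
  have : D2 (fun x y => b0 x y * (b0 x y * D1 b0 x y)) x y = - m * D2 z x y.
    by rewrite E D2_scal //; apply: smooth2_once.
  have oD := smooth2_once _ (smooth2_D1 _ s0).
  rewrite D2_mult //; last exact/smooth2_once/smooth2_mult/smooth2_D1.
  rewrite D2_mult // D2D1 // -/z z1 z2 => h.
  (* At a critical point of [z] the differentiated equation leaves 2 b0 z (b0)_x = 0; multiplying by
     b0 and using [burgers] turns this into m z^2 = 0. *)
  have h' : b0 x y * (z x y * D1 b0 x y) = 0 by lra.
  have : m * (z x y * z x y) = 0.
    have := burgers x y; rewrite -/z => hz.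
    have -> : m * (z x y * z x y) = - z x y * (- m * z x y) by ring.
    rewrite -hz; have -> : - z x y * (b0 x y ^ 2 * D1 b0 x y) =
      - b0 x y * (b0 x y * (z x y * D1 b0 x y)) by ring.
    by rewrite h'; ring.
  by move=> /Rmult_integral [//|/Rmult_integral [|]].
have bound f : torus_fun w1 w2 f -> (forall x y, D1 f x y = 0 -> D2 f x y = 0 -> f x y = 0) ->
    forall x y, f x y <= 0.
  move=> [sf pf] cf x y; have [p [q h]] := periodic_max w1 w2 f hb pf (smooth2_cont _ sf).
  have <- // : f p q = 0; apply: cf.
    by apply: (derive_at_max (fun t => f t q) p) => //; apply: smooth2_is_derive1.
  by apply: (derive_at_max (fun t => f p t) q) => //; apply: smooth2_is_derive2.
have tz := torus_fun_D2 w1 w2 _ t0.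
have z0 x y : z x y = 0.
  apply: Rle_antisym; first exact: bound.
  suff : -1 * z x y <= 0 by lra.
  apply: (bound (fun x y => -1 * z x y)); first exact: torus_fun_scal.
  move=> s t; have oz := smooth2_once _ sz.
  by rewrite D1_scal // D2_scal // => h1 h2; rewrite (crit s t); lra.
move=> x y; split; first exact: z0.
have nz : b0 x y <> 0 by move=> h; have := em x y; rewrite h; lra.
have := burgers x y; rewrite -/z z0 Rmult_0_r => /Rmult_integral [|h1].
  by move=> h; have := pow_nonzero _ 2 nz.
have := m1 x y; rewrite h1 Rmult_0_l Rplus_0_l.
by move=> /Rmult_integral [].
Qed.

(** Where b1 is non-zero, b0 = 0 and the differentiated product gives (b0)_x = 0, hence (b1)_y = 0;
    so b1^2 does not depend on y, and symmetrically b0^2 does not depend on x. A non-zero value of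
    b0 then persists along a horizontal line, b1 vanishes on that line, and so b1 vanishes on every
    vertical line. *)
Lemma product_zero b0 b1 : smooth2 b0 -> smooth2 b1 ->
  (forall x y, D1 b0 x y = D2 b1 x y) ->
  (forall x y, b0 x y * b1 x y = 0) ->
  (forall x y, b0 x y = 0) \/ (forall x y, b1 x y = 0).
Proof.
move=> s0 s1 e1 em.
have o0 := smooth2_once _ s0; have o1 := smooth2_once _ s1.
have Em : (fun x y => b0 x y * b1 x y) = fun _ _ => 0.
  by apply/funext=> x; apply/funext=> y.
have m1 x y : D1 b0 x y * b1 x y + b0 x y * D1 b1 x y = 0.
  rewrite -[LHS]/((fun x y => D1 b0 x y * b1 x y + b0 x y * D1 b1 x y) x y).
  by rewrite -D1_mult // Em; apply: Derive_const.
have m2 x y : D2 b0 x y * b1 x y + b0 x y * D2 b1 x y = 0.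
  rewrite -[LHS]/((fun x y => D2 b0 x y * b1 x y + b0 x y * D2 b1 x y) x y).
  by rewrite -D2_mult // Em; apply: Derive_const.
have sq1 x y y' : b1 x y * b1 x y = b1 x y' * b1 x y'.
  apply: (D2_zero_const (fun x y => b1 x y * b1 x y)) => [|s t].
    exact/smooth2_once/smooth2_mult.
  rewrite D2_mult // -e1.
  case: (Req_dec (b1 s t) 0) => [->|h]; first ring.
  have := em s t => /Rmult_integral [h0|//].
  have := m1 s t; rewrite h0 Rmult_0_l Rplus_0_r => /Rmult_integral [->|//]; ring.
have sq0 x x' y : b0 x y * b0 x y = b0 x' y * b0 x' y.
  apply: (D1_zero_const (fun x y => b0 x y * b0 x y)) => [|s t].
    exact/smooth2_once/smooth2_mult.
  rewrite D1_mult // e1.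
  case: (Req_dec (b0 s t) 0) => [->|h]; first ring.
  have := em s t => /Rmult_integral [//|h0].
  have := m2 s t; rewrite h0 Rmult_0_r Rplus_0_l => /Rmult_integral [//|->]; ring.
case: (pselect (forall x y, b1 x y = 0)) => [|h1]; first by right.
left=> x y; apply: contrapT => h0; apply: h1 => u v.
have h2 : b0 u y <> 0.
  move=> h; have := sq0 u x y; rewrite h Rmult_0_l => /esym /Rmult_integral.
  by case.
have h3 : b1 u y = 0 by have := em u y => /Rmult_integral [].
by have := sq1 u v y; rewrite h3 Rmult_0_l => /Rmult_integral [].
Qed.

(** * Rotations *)

Record coeffs := Coeffs { qa0 : R -> R -> R; qa1 : R -> R -> R; qa2 : R -> R -> R;
  qb0 : R -> R -> R; qb1 : R -> R -> R; qc : R -> R -> R }.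

Definition quad (q : coeffs) : phase_fun := fun x y p1 p2 =>
  qa0 q x y * p1 ^ 2 + 2 * qa1 q x y * p1 * p2 + qa2 q x y * p2 ^ 2
  + qb0 q x y * p1 + qb1 q x y * p2 + qc q x y.

(* The bracket of quad q and H multiplied by 2 Lam^2, which is polynomial in
   the coefficients and their derivatives. *)
Definition flow_equation (Lam Om : R -> R -> R) (q : coeffs) : Prop :=
  forall x y p1 p2,
  2 * Lam x y *
    (p1 * quad (Coeffs (D1 (qa0 q)) (D1 (qa1 q)) (D1 (qa2 q))
                       (D1 (qb0 q)) (D1 (qb1 q)) (D1 (qc q))) x y p1 p2 +
     p2 * quad (Coeffs (D2 (qa0 q)) (D2 (qa1 q)) (D2 (qa2 q))
                       (D2 (qb0 q)) (D2 (qb1 q)) (D2 (qc q))) x y p1 p2)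
  + (p1 ^ 2 + p2 ^ 2) *
    (D1 Lam x y * (2 * qa0 q x y * p1 + 2 * qa1 q x y * p2 + qb0 q x y) +
     D2 Lam x y * (2 * qa1 q x y * p1 + 2 * qa2 q x y * p2 + qb1 q x y))
  + 2 * Lam x y * Om x y *
    (p2 * (2 * qa0 q x y * p1 + 2 * qa1 q x y * p2 + qb0 q x y) -
     p1 * (2 * qa1 q x y * p1 + 2 * qa2 q x y * p2 + qb1 q x y)) = 0.

Record quadratic_flow (w1 w2 : R * R) (Lam Om : R -> R -> R) (q : coeffs) : Prop := {
  qf_torus : magnetic_torus w1 w2 Lam Om;
  qf_nonzero : exists x y, Om x y <> 0;
  qf_a0 : torus_fun w1 w2 (qa0 q);
  qf_a1 : torus_fun w1 w2 (qa1 q);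
  qf_a2 : torus_fun w1 w2 (qa2 q);
  qf_b0 : torus_fun w1 w2 (qb0 q);
  qf_b1 : torus_fun w1 w2 (qb1 q);
  qf_c : torus_fun w1 w2 (qc q);
  qf_eq : flow_equation Lam Om q
}.

(* The second alternative is excluded by functional independence of F and H. *)
Definition normal_form (w1 w2 : R * R) (Lam Om : R -> R -> R) (F : phase_fun) : Prop :=
  (exists (c s : R) (lam u : R -> R) (al be ga de : R),
    c ^ 2 + s ^ 2 = 1 /\ smooth1 lam /\ smooth1 u /\
    (forall x y, Lam x y = lam (c * y - s * x)) /\
    (forall x y, Om x y = - Derive u (c * y - s * x)) /\
    doubly_periodic w1 w2 (fun x y => u (c * y - s * x)) /\
    forall x y p1 p2, let F1 := c * p1 + s * p2 + u (c * y - s * x) in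
      F x y p1 p2 = al * Ham Lam x y p1 p2 + be * F1 ^ 2 + ga * F1 + de) \/
  exists al de, forall x y p1 p2, F x y p1 p2 = al * Ham Lam x y p1 p2 + de.

Lemma D1_lincomb2 k l f g : smooth2 f -> smooth2 g ->
  D1 (fun x y => k * f x y + l * g x y) = fun x y => k * D1 f x y + l * D1 g x y.
Proof.
move=> hf hg; rewrite D1_plus; try exact/smooth2_once/smooth2_scal.
by rewrite !D1_scal //; apply: smooth2_once.
Qed.

Lemma D2_lincomb2 k l f g : smooth2 f -> smooth2 g ->
  D2 (fun x y => k * f x y + l * g x y) = fun x y => k * D2 f x y + l * D2 g x y.
Proof.
move=> hf hg; rewrite D2_plus; try exact/smooth2_once/smooth2_scal.
by rewrite !D2_scal //; apply: smooth2_once.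
Qed.

Lemma smooth2_lincomb2 k l f g : smooth2 f -> smooth2 g ->
  smooth2 (fun x y => k * f x y + l * g x y).
Proof. by move=> hf hg; apply: smooth2_plus; apply: smooth2_scal. Qed.

Lemma D1_lincomb3 k l m f g h : smooth2 f -> smooth2 g -> smooth2 h ->
  D1 (fun x y => k * f x y + l * g x y + m * h x y) =
  fun x y => k * D1 f x y + l * D1 g x y + m * D1 h x y.
Proof.
move=> hf hg hh; rewrite D1_plus; try exact/smooth2_once/smooth2_scal.
  by rewrite D1_lincomb2 // !D1_scal //; apply: smooth2_once.
exact/smooth2_once/smooth2_lincomb2.
Qed.

Lemma D2_lincomb3 k l m f g h : smooth2 f -> smooth2 g -> smooth2 h ->
  D2 (fun x y => k * f x y + l * g x y + m * h x y) =
  fun x y => k * D2 f x y + l * D2 g x y + m * D2 h x y.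
Proof.
move=> hf hg hh; rewrite D2_plus; try exact/smooth2_once/smooth2_scal.
  by rewrite D2_lincomb2 // !D2_scal //; apply: smooth2_once.
exact/smooth2_once/smooth2_lincomb2.
Qed.

Section Rotation.
Variables c s : R.
Hypothesis cs1 : c ^ 2 + s ^ 2 = 1.

(** This is [f] expressed in the new coordinates X = c x + s y, Y = c y - s x; hence the inverse
    rotation inside. The form [+ - s * y] makes it an instance of the general linear change
    above. *)
Definition rotate (f : R -> R -> R) x y : R :=
  f (c * x + - s * y) (s * x + c * y).

Definition rotate_pt (w : R * R) : R * R :=
  (c * fst w + s * snd w, c * snd w - s * fst w).

(** Coefficients obtained by substituting the old momenta (c p1 - s p2, s p1 + c p2) and collecting
    powers: the quadratic part is conjugated by the rotation, and the linear part is rotated. *)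
Definition rotate_coeffs (q : coeffs) : coeffs :=
  let r := fun f => rotate f in
  Coeffs
    (fun x y => c ^ 2 * r (qa0 q) x y + 2 * c * s * r (qa1 q) x y + s ^ 2 * r (qa2 q) x y)
    (fun x y => - (c * s) * r (qa0 q) x y + (c ^ 2 - s ^ 2) * r (qa1 q) x y
                + c * s * r (qa2 q) x y)
    (fun x y => s ^ 2 * r (qa0 q) x y + - (2 * c * s) * r (qa1 q) x y + c ^ 2 * r (qa2 q) x y)
    (fun x y => c * r (qb0 q) x y + s * r (qb1 q) x y)
    (fun x y => - s * r (qb0 q) x y + c * r (qb1 q) x y)
    (r (qc q)).

Lemma rotateK f x y : rotate f (c * x + s * y) (c * y - s * x) = f x y.
Proof.
rewrite /rotate.
have -> : c * (c * x + s * y) + - s * (c * y - s * x) = (c ^ 2 + s ^ 2) * x by ring.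
have -> : s * (c * x + s * y) + c * (c * y - s * x) = (c ^ 2 + s ^ 2) * y by ring.
by rewrite cs1 !Rmult_1_l.
Qed.

Lemma is_basis_rotate w1 w2 : is_basis w1 w2 ->
  is_basis (rotate_pt w1) (rotate_pt w2).
Proof.
rewrite /is_basis /rotate_pt /=.
have -> : (c * w1.1 + s * w1.2) * (c * w2.2 - s * w2.1) -
    (c * w1.2 - s * w1.1) * (c * w2.1 + s * w2.2) =
    (c ^ 2 + s ^ 2) * (w1.1 * w2.2 - w1.2 * w2.1) by ring.
by rewrite cs1 Rmult_1_l.
Qed.

Lemma rotate_torus_fun w1 w2 f :
  torus_fun w1 w2 f -> torus_fun (rotate_pt w1) (rotate_pt w2) (rotate f).
Proof.
move=> [sf pf]; split; first exact: smooth2_pull.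
have shift w x y : rotate f (x + fst (rotate_pt w)) (y + snd (rotate_pt w)) =
    f (c * x + - s * y + fst w) (s * x + c * y + snd w).
  rewrite /rotate /rotate_pt /=; congr f.
    rewrite -[X in _ = _ + X]Rmult_1_l -cs1; ring.
  rewrite -[X in _ = _ + X]Rmult_1_l -cs1; ring.
by move=> x y; rewrite !shift; apply: pf.
Qed.

Lemma D1_rotate f : smooth2 f ->
  D1 (rotate f) = fun x y => c * rotate (D1 f) x y + s * rotate (D2 f) x y.
Proof. exact: D1_pull. Qed.

Lemma D2_rotate f : smooth2 f ->
  D2 (rotate f) = fun x y => - s * rotate (D1 f) x y + c * rotate (D2 f) x y.
Proof. exact: D2_pull. Qed.

Lemma rotate_smooth2 f : smooth2 f -> smooth2 (rotate f).
Proof. exact: smooth2_pull. Qed.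

Lemma rotate_quad q x y p1 p2 : quad (rotate_coeffs q) x y p1 p2 =
  quad q (c * x + - s * y) (s * x + c * y) (c * p1 - s * p2) (s * p1 + c * p2).
Proof. by rewrite /quad /rotate_coeffs /rotate /=; ring. Qed.

(** The flow equation is covariant: for the rotated data it is the old equation at the rotated point
    and rotated momenta. *)
Lemma rotate_quadratic_flow w1 w2 Lam Om q : quadratic_flow w1 w2 Lam Om q ->
  quadratic_flow (rotate_pt w1) (rotate_pt w2) (rotate Lam) (rotate Om)
    (rotate_coeffs q).
Proof.
case=> -[hb tL Lpos tO] [x0 [y0 hO]] t0 t1 t2 u0 u1 u2 heq.
have tf f := rotate_torus_fun w1 w2 f.
split.
- by split; [exact: is_basis_rotate | exact: tf | move=> x y; apply: Lpos | exact: tf].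
- by exists (c * x0 + s * y0), (c * y0 - s * x0); rewrite rotateK.
- by do 2 (try apply: torus_fun_plus); apply: torus_fun_scal; apply: tf.
- by do 2 (try apply: torus_fun_plus); apply: torus_fun_scal; apply: tf.
- by do 2 (try apply: torus_fun_plus); apply: torus_fun_scal; apply: tf.
- by apply: torus_fun_plus; apply: torus_fun_scal; apply: tf.
- by apply: torus_fun_plus; apply: torus_fun_scal; apply: tf.
- exact: tf.
move: tL tO t0 t1 t2 u0 u1 u2 => [sL _] [sO _] [s0 _] [s1 _] [s2 _] [r0 _] [r1 _] [r2 _].
move=> x y p1 p2.
have := heq (c * x + - s * y) (s * x + c * y) (c * p1 - s * p2) (s * p1 + c * p2).
rewrite /quad /rotate_coeffs /=.
rewrite !D1_lincomb3 ?D2_lincomb3 ?D1_lincomb2 ?D2_lincomb2;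
  try exact: rotate_smooth2.
rewrite !D1_rotate // !D2_rotate // /rotate.
set x' := c * x + - s * y; set y' := s * x + c * y.
move=> e; rewrite -[RHS]e; ring.
Qed.

Lemma rotate_normal_form w1 w2 Lam Om q :
  normal_form (rotate_pt w1) (rotate_pt w2) (rotate Lam) (rotate Om)
    (quad (rotate_coeffs q)) ->
  normal_form w1 w2 Lam Om (quad q).
Proof.
have quadE x y p1 p2 : quad q x y p1 p2 =
    quad (rotate_coeffs q) (c * x + s * y) (c * y - s * x)
      (c * p1 + s * p2) (c * p2 - s * p1).
  rewrite rotate_quad; congr quad.
  - by rewrite -[LHS]Rmult_1_l -cs1; ring.
  - by rewrite -[LHS]Rmult_1_l -cs1; ring.
  - by rewrite -[LHS]Rmult_1_l -cs1; ring.
  - by rewrite -[LHS]Rmult_1_l -cs1; ring.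
have HamE x y p1 p2 : Ham (rotate Lam) (c * x + s * y) (c * y - s * x)
    (c * p1 + s * p2) (c * p2 - s * p1) = Ham Lam x y p1 p2.
  rewrite /Ham rotateK; congr (_ * _).
  by rewrite -[RHS]Rmult_1_l -cs1; ring.
case=> [[c' [s' [lam [u [al [be [ga [de [cs' [sl [su [eL [eO [pu eF]]]]]]]]]]]]]]|].
  (* Addition formulas: the two angles add up. *)
  left; exists (c * c' - s * s'), (c * s' + s * c'), lam, u, al, be, ga, de.
  have eY x y : (c * c' - s * s') * y - (c * s' + s * c') * x =
      c' * (c * y - s * x) - s' * (c * x + s * y) by ring.
  split; first by rewrite -[RHS]Rmult_1_l -{1}cs1 -cs'; ring.
  do 2 split=> //.
  split; first by move=> x y; rewrite eY -eL rotateK.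
  split; first by move=> x y; rewrite eY -eO rotateK.
  split.
    move=> x y; have [e1 e2] := pu (c * x + s * y) (c * y - s * x).
    by rewrite !eY; split; [rewrite -e1 | rewrite -e2]; congr u; rewrite /rotate_pt /=; ring.
  move=> x y p1 p2 F1; rewrite quadE eF /= HamE /F1 eY.
  have -> : (c * c' - s * s') * p1 + (c * s' + s * c') * p2 =
    c' * (c * p1 + s * p2) + s' * (c * p2 - s * p1) by ring.
  by [].
case=> al [de eF]; right; exists al, de => x y p1 p2.
by rewrite quadE eF HamE.
Qed.

End Rotation.

(** * Normal form *)

(** Three points on each axis isolate the pure powers and the four diagonal points the mixed terms,
    so ten values give a linear system with only the zero solution. *)
Lemma cubic_zero c30 c21 c12 c03 c20 c11 c02 c10 c01 :
  (forall p1 p2, c30 * p1 ^ 3 + c21 * p1 ^ 2 * p2 + c12 * p1 * p2 ^ 2 + c03 * p2 ^ 3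
    + c20 * p1 ^ 2 + c11 * p1 * p2 + c02 * p2 ^ 2 + c10 * p1 + c01 * p2 = 0) ->
  (c30 = 0 /\ c21 = 0 /\ c12 = 0 /\ c03 = 0) /\ (c20 = 0 /\ c11 = 0 /\ c02 = 0) /\
  c10 = 0 /\ c01 = 0.
Proof.
move=> h.
have := h 1 0; have := h (-1) 0; have := h 2 0.
have := h 0 1; have := h 0 (-1); have := h 0 2.
have := h 1 1; have := h (-1) (-1); have := h 1 (-1); have := h (-1) 1.
by lra.
Qed.

Section FlowEquations.
Variables (w1 w2 : R * R) (Lam Om : R -> R -> R) (q : coeffs).
Hypothesis hq : quadratic_flow w1 w2 Lam Om q.

Let Lpos x y : 0 < Lam x y.
Proof. by case: hq => -[]. Qed.

Let factor x y t : 2 * Lam x y * t = 0 -> t = 0.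
Proof. by move=> /Rmult_integral [|//]; have := Lpos x y; lra. Qed.

(** The three groups come from degrees three, two and one in the momenta. The equations free of
    [Lam] and its derivatives in the first two groups are differences such as c30 - c12 and c20 -
    c02, in which the derivatives of [Lam] cancel, or the coefficient of p1 p2, where none occur. *)
Lemma flow_equation_coeffs x y :
  (D1 (qa0 q) x y - D1 (qa2 q) x y = 2 * D2 (qa1 q) x y /\
   D2 (qa0 q) x y - D2 (qa2 q) x y = - 2 * D1 (qa1 q) x y /\
   Lam x y * D1 (qa0 q) x y + D1 Lam x y * qa0 q x y + D2 Lam x y * qa1 q x y = 0 /\
   Lam x y * D2 (qa2 q) x y + D1 Lam x y * qa1 q x y + D2 Lam x y * qa2 q x y = 0) /\
  (D1 (qb0 q) x y - D2 (qb1 q) x y = 4 * Om x y * qa1 q x y /\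
   2 * Lam x y * D1 (qb0 q) x y + D1 Lam x y * qb0 q x y + D2 Lam x y * qb1 q x y =
     4 * Lam x y * Om x y * qa1 q x y /\
   D2 (qb0 q) x y + D1 (qb1 q) x y = - 2 * Om x y * (qa0 q x y - qa2 q x y)) /\
  D1 (qc q) x y = Om x y * qb1 q x y /\ D2 (qc q) x y = - Om x y * qb0 q x y.
Proof.
have h := qf_eq _ _ _ _ _ hq x y; rewrite /quad /= in h.
have Lxy := Lpos x y; have fac := factor x y; move: h Lxy fac.
set L := Lam x y; set L1 := D1 Lam x y; set L2 := D2 Lam x y; set O := Om x y.
set a0 := qa0 q x y; set a1 := qa1 q x y; set a2 := qa2 q x y.
set b0 := qb0 q x y; set b1 := qb1 q x y.
move=> h Lxy fac.
have [[e30 [e21 [e12 e03]]] [[e20 [e11 e02]] [e10 e01]]] := cubic_zero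
  (2 * L * D1 (qa0 q) x y + 2 * (L1 * a0 + L2 * a1))
  (2 * L * (2 * D1 (qa1 q) x y + D2 (qa0 q) x y) + 2 * (L1 * a1 + L2 * a2))
  (2 * L * (D1 (qa2 q) x y + 2 * D2 (qa1 q) x y) + 2 * (L1 * a0 + L2 * a1))
  (2 * L * D2 (qa2 q) x y + 2 * (L1 * a1 + L2 * a2))
  (2 * L * D1 (qb0 q) x y + (L1 * b0 + L2 * b1) - 4 * L * O * a1)
  (2 * L * (D2 (qb0 q) x y + D1 (qb1 q) x y) + 4 * L * O * (a0 - a2))
  (2 * L * D2 (qb1 q) x y + (L1 * b0 + L2 * b1) + 4 * L * O * a1)
  (2 * L * (D1 (qc q) x y - O * b1)) (2 * L * (D2 (qc q) x y + O * b0))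
  ltac:(move=> p1 p2; rewrite -(h p1 p2); ring).
do !split; try lra.
- by apply: Rminus_diag_uniq; apply: fac; lra.
- by apply: Rminus_diag_uniq; apply: fac; lra.
- by apply: Rminus_diag_uniq; apply: fac; lra.
- by apply: Rminus_diag_uniq; apply: fac; lra.
- by apply: Rminus_diag_uniq; apply: fac; lra.
- by apply: Rminus_diag_uniq; apply: fac; lra.
Qed.

Lemma traceless_part_const :
  exists A B, forall x y, qa0 q x y - qa2 q x y = A /\ 2 * qa1 q x y = B.
Proof.
have s0 := qf_a0 _ _ _ _ _ hq; have s1 := qf_a1 _ _ _ _ _ hq.
have s2 := qf_a2 _ _ _ _ _ hq; have [? _] := s0; have [? _] := s1; have [? _] := s2.
have [] := cauchy_riemann_const w1 w2
  (fun x y => 1 * qa0 q x y + -1 * qa2 q x y) (fun x y => 2 * qa1 q x y).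
- by case: hq => -[].
- by apply: torus_fun_plus; apply: torus_fun_scal.
- exact: torus_fun_scal.
- move=> x y; rewrite D1_lincomb2 // D2_scal; last exact: smooth2_once.
  by have [[e _] _] := flow_equation_coeffs x y; lra.
- move=> x y; rewrite D2_lincomb2 // D1_scal; last exact: smooth2_once.
  by have [[_ [e _]] _] := flow_equation_coeffs x y; lra.
by move=> A [B h]; exists A, B => x y; have [] := h x y; lra.
Qed.

End FlowEquations.

Lemma smooth1_slice f x : smooth2 f -> smooth1 (fun y => f x y).
Proof.
move=> hf; case=> [|n] y //=.
suff [g [hg ->]] : exists g, smooth2 g /\ Derive_n (fun y => f x y) n = fun y => g x y.
  by have [_ [_ ?]] := smooth2_once _ hg x y.
elim: n => [|n [g [hg e]]] /=; first by exists f.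
by exists (D2 g); split; [exact: smooth2_D2 | rewrite e].
Qed.

Lemma both_zero_const f : diff_once f -> (forall x y, D1 f x y = 0) ->
  (forall x y, D2 f x y = 0) -> forall x y, f x y = f 0 0.
Proof.
move=> hf h1 h2 x y.
by rewrite (D1_zero_const f hf h1 x 0) (D2_zero_const f hf h2 0 y 0).
Qed.

(* Here the metric depends on y only and b0 p1 + c0 completes the square of
   p1 + u. *)
Lemma aligned_normal_form w1 w2 Lam Om q k : quadratic_flow w1 w2 Lam Om q ->
  (forall x y, qa1 q x y = 0) -> (forall x y, qa0 q x y - qa2 q x y = k) ->
  (forall x y, qb1 q x y = 0) -> normal_form w1 w2 Lam Om (quad q).
Proof.
move=> hq a10 a02 b10.
have [sL pL] : torus_fun w1 w2 Lam by case: hq => -[].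
have Lgt x y : 0 < Lam x y by case: hq => -[].
have Lpos x y : Lam x y <> 0 by apply/Rgt_not_eq/Lgt.
have [sa0 _] := qf_a0 _ _ _ _ _ hq; have [sa2 _] := qf_a2 _ _ _ _ _ hq.
have [sb pb] := qf_b0 _ _ _ _ _ hq; have [sc pc] := qf_c _ _ _ _ _ hq.
have ob := smooth2_once _ sb; have oc := smooth2_once _ sc.
have oL := smooth2_once _ sL.
have D10 : D1 (qb1 q) = fun _ _ => 0.
  rewrite (_ : qb1 q = fun _ _ => 0); last by apply/funext=> x; apply/funext=> y.
  by apply: D1_eq => x y; auto_derive.
have D20 : D2 (qb1 q) = fun _ _ => 0.
  rewrite (_ : qb1 q = fun _ _ => 0); last by apply/funext=> x; apply/funext=> y.
  by apply: D2_eq => x y; auto_derive.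
have eqs := flow_equation_coeffs _ _ _ _ _ hq.
have b1 x y : D1 (qb0 q) x y = 0.
  by have [_ [[+ _] _]] := eqs x y; rewrite D20 a10; lra.
have b2 x y : D2 (qb0 q) x y = - 2 * k * Om x y.
  by have [_ [[_ [_ +]] _]] := eqs x y; rewrite D10 a02; lra.
have bL x y : D1 Lam x y * qb0 q x y = 0.
  by have [_ [[_ [+ _]] _]] := eqs x y; rewrite b1 a10 b10; lra.
have c1 x y : D1 (qc q) x y = 0.
  by have [_ [_ [+ _]]] := eqs x y; rewrite b10; lra.
have c2 x y : D2 (qc q) x y = - Om x y * qb0 q x y by have [_ [_ [_ +]]] := eqs x y.
(* With a1 = 0, the remaining cubic equations read (Lam a0)_x = 0 and (Lam a2)_y = 0. *)
have La0 x x' y : Lam x y * qa0 q x y = Lam x' y * qa0 q x' y.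
  apply: (D1_zero_const (fun x y => Lam x y * qa0 q x y)) => [|s t].
    exact/smooth2_once/smooth2_mult.
  rewrite D1_mult //; last exact: smooth2_once.
  by have [[_ [_ [+ _]]] _] := eqs s t; rewrite a10; lra.
have La2 x y y' : Lam x y * qa2 q x y = Lam x y' * qa2 q x y'.
  apply: (D2_zero_const (fun x y => Lam x y * qa2 q x y)) => [|s t].
    exact/smooth2_once/smooth2_mult.
  rewrite D2_mult //; last exact: smooth2_once.
  by have [[_ [_ [_ +]]] _] := eqs s t; rewrite a10; lra.
have bx x x' y : qb0 q x y = qb0 q x' y by apply: D1_zero_const.
have cx x x' y : qc q x y = qc q x' y by apply: D1_zero_const.
have a0E x y : qa0 q x y = qa2 q x y + k by have := a02 x y; lra.
(* If b0 vanishes, so does (b0)_y = - 2 k Om; as Om is non-zero somewhere, k = 0 and F is affine in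
   H. *)
case: (pselect (forall x y, qb0 q x y = 0)) => [b0|/existsNP [x0 /existsNP [y0 nb]]].
  have k0 : k = 0.
    have [x [y nO]] := qf_nonzero _ _ _ _ _ hq.
    have : D2 (qb0 q) x y = 0.
      rewrite (_ : qb0 q = fun _ _ => 0); first exact: Derive_const.
      by apply/funext=> s; apply/funext=> t.
    by rewrite b2 => /Rmult_integral [h|//]; lra.
  right; exists (2 * (Lam 0 0 * qa2 q 0 0)), (qc q 0 0) => x y p1 p2.
  have -> : Lam 0 0 * qa2 q 0 0 = Lam x y * qa2 q x y.
    by rewrite (La2 x y 0); have := La0 x 0 0; rewrite !a0E k0; lra.
  have <- : qc q x y = qc q 0 0.
    by apply: both_zero_const => // s t; rewrite c2 b0; lra.
  rewrite /quad /Ham a10 b10 b0 a0E k0.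
  by field; apply: Lpos.
(* On the line y = y0, where b0 is non-zero, Lam_x b0 = 0 makes Lam independent of x. If k = 0, b0
   is a non-zero constant and the same holds on every line. If k <> 0, k Lam = Lam a0 - Lam a2 is a
   function of y minus a function of x (Liouville form), so its dependence on x is already visible
   at y = y0. *)
have Lx x x' y : Lam x y = Lam x' y.
  have Ly0 s s' : Lam s y0 = Lam s' y0.
    apply: (derive_zero_const (fun t => Lam t y0)) => t.
    rewrite (_ : 0 = D1 Lam t y0); first exact: diff_once_is_derive1.
    have /Rmult_integral [->|] // := bL t y0.
    by rewrite (bx t x0).
  case: (Req_dec k 0) => [k0|k0].
    apply: D1_zero_const => // s t.
    have /Rmult_integral [//|] := bL s t.
    rewrite (bx s x0) (D2_zero_const _ ob _ x0 t y0) // => s' t'.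
    by rewrite b2 k0; ring.
  apply: (Rmult_eq_reg_l k) => //.
  have hk s t : k * Lam s t = Lam 0 t * qa0 q 0 t - Lam s y0 * qa2 q s y0.
    by rewrite (La0 0 s) (La2 s y0 t) a0E; ring.
  have h : k * Lam x y0 = k * Lam x' y0 by rewrite (Ly0 x x').
  by rewrite !hk in h *; lra.
have L2 x y : Lam x y * qa2 q x y = Lam 0 0 * qa2 q 0 0.
  rewrite (La2 x y 0); have := La0 x 0 0; rewrite !a0E.
  by rewrite (Lx x 0 0); lra.
have quadE x y p1 p2 : quad q x y p1 p2 =
    2 * (Lam 0 0 * qa2 q 0 0) * Ham Lam x y p1 p2 +
    (k * p1 ^ 2 + qb0 q 0 y * p1 + qc q 0 y).
  rewrite -(L2 x y) /quad /Ham a10 b10 a0E (bx x 0) (cx x 0).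
  by field; apply: Lpos.
have slice f x y : smooth2 f -> Derive (fun y => f x y) y = D2 f x y by [].
have lin x y : 1 * y - 0 * x = y by ring.
case: (Req_dec k 0) => [k0|k0].
  (* No square is present: b0 p1 + c0 = beta (p1 + c0 / beta), so u = c0 / beta and F is linear in
     F1. *)
  pose beta := qb0 q 0 0.
  have bconst y : qb0 q 0 y = beta.
    by apply: both_zero_const => // s t; rewrite b2 k0; ring.
  have beta0 : beta <> 0 by rewrite -(bconst y0) (bx 0 x0).
  pose g x y := / beta * qc q x y.
  have sg : smooth2 g by apply: smooth2_scal.
  left; exists 1, 0, (fun y => Lam 0 y), (fun y => g 0 y),
    (2 * (Lam 0 0 * qa2 q 0 0)), 0, beta, 0.
  split; first ring.
  do 2 (split; first exact: smooth1_slice).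
  split; first by move=> x y; rewrite lin (Lx x 0).
  split.
    move=> x y; rewrite lin slice // D2_scal // c2 bconst.
    have -> : Om x y = Om 0 y.
      have := c2 x y; have := c2 0 y; rewrite (bx x 0) bconst.
      have -> : D2 (qc q) x y = D2 (qc q) 0 y.
        by apply: Derive_ext => t; apply: cx.
      by move=> -> h; apply: (Rmult_eq_reg_r beta); lra.
    by field.
  split.
    move=> x y; rewrite /g !lin.
    by have [h1 h2] := pc x y; split; congr (_ * _); rewrite (cx 0 x y);
      [rewrite -h1 | rewrite -h2]; apply: cx.
  by move=> x y p1 p2; rewrite quadE /g bconst k0 lin /=; field.
pose g x y := / (2 * k) * qb0 q x y.
have sg : smooth2 g by apply: smooth2_scal.
have gE y : qb0 q 0 y = 2 * k * g 0 y by rewrite /g; field.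
(* Remainder of the completed square, c0 - k u^2; it is constant because (c0)_y = - Om b0 = 2 k u
   u'. *)
pose de := qc q 0 0 - k * g 0 0 ^ 2.
left; exists 1, 0, (fun y => Lam 0 y), (fun y => g 0 y),
  (2 * (Lam 0 0 * qa2 q 0 0)), k, 0, de.
have g2 y : D2 g 0 y = - Om 0 y by rewrite D2_scal // b2; field.
have Ox x y : Om x y = Om 0 y.
  have -> : Om x y = - (D2 (qb0 q) x y) / (2 * k) by rewrite b2; field.
  have -> : D2 (qb0 q) x y = D2 (qb0 q) 0 y by apply: Derive_ext => t; apply: bx.
  by rewrite b2; field.
have deE y : qc q 0 y - k * g 0 y ^ 2 = de.
  rewrite /de; apply: (derive_zero_const (fun y => qc q 0 y - k * g 0 y ^ 2)) => t.
  have d1 : is_derive (fun t => g 0 t) t (- Om 0 t).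
    by rewrite -g2; apply: smooth2_is_derive2.
  have d2 : is_derive (fun t => qc q 0 t) t (- Om 0 t * (2 * k * g 0 t)).
    by rewrite -gE -c2; apply: smooth2_is_derive2.
  have d3 := is_derive_scal _ _ k _ (is_derive_pow _ 2 _ _ d1).
  have := is_derive_minus _ _ _ _ _ d2 d3.
  by rewrite (_ : minus _ _ = 0) // /minus /plus /opp /scal /= /mult /=; ring.
split; first ring.
do 2 (split; first exact: smooth1_slice).
split; first by move=> x y; rewrite lin (Lx x 0).
split; first by move=> x y; rewrite lin slice // g2 Ox; ring.
split.
  move=> x y; rewrite /g !lin.
  by have [h1 h2] := pb x y; split; congr (_ * _); rewrite (bx 0 x y);
    [rewrite -h1 | rewrite -h2]; apply: bx.
by move=> x y p1 p2; rewrite quadE -(deE y) gE lin /=; ring.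
Qed.

Lemma diagonal_normal_form w1 w2 Lam Om q k : quadratic_flow w1 w2 Lam Om q ->
  (forall x y, qa1 q x y = 0) -> (forall x y, qa0 q x y - qa2 q x y = k) ->
  normal_form w1 w2 Lam Om (quad q).
Proof.
move=> hq a10 a02.
have hb : is_basis w1 w2 by case: hq => -[].
have tb0 := qf_b0 _ _ _ _ _ hq; have tb1 := qf_b1 _ _ _ _ _ hq.
have [sb0 _] := tb0; have [sb1 _] := tb1.
have [sc _] := qf_c _ _ _ _ _ hq.
have [sO _] : torus_fun w1 w2 Om by case: hq => -[].
have eqs := flow_equation_coeffs _ _ _ _ _ hq.
have e1 x y : D1 (qb0 q) x y = D2 (qb1 q) x y.
  by have [_ [[+ _] _]] := eqs x y; rewrite a10; lra.
have e2 x y : D2 (qb0 q) x y + D1 (qb1 q) x y = - 2 * k * Om x y.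
  by have [_ [[_ [_ +]] _]] := eqs x y; rewrite a02; lra.
(* A rotation creates the off-diagonal coefficient - c s k. Hence every angle is allowed when k = 0,
   but only multiples of a quarter turn when k <> 0. *)
have align c s : c ^ 2 + s ^ 2 = 1 -> c * s * k = 0 ->
    (forall x y, - s * qb0 q x y + c * qb1 q x y = 0) ->
    normal_form w1 w2 Lam Om (quad q).
  move=> cs1 csk bb; apply: (rotate_normal_form c s) => //.
  apply: (aligned_normal_form _ _ _ _ _ ((c ^ 2 - s ^ 2) * k)).
  - exact: rotate_quadratic_flow.
  - move=> x y; rewrite /rotate_coeffs /rotate /= a10.
    transitivity (- (c * s * k)); last by rewrite csk; ring.
    by rewrite -(a02 (c * x + - s * y) (s * x + c * y)); ring.
  - move=> x y; rewrite /rotate_coeffs /rotate /= a10.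
    by rewrite -(a02 (c * x + - s * y) (s * x + c * y)); ring.
  - by move=> x y; rewrite /rotate_coeffs /rotate /= bb.
case: (Req_dec k 0) => [k0|k0].
  have [b [b' hbb]] : exists b b', forall x y, qb0 q x y = b /\ qb1 q x y = b'.
    apply: (cauchy_riemann_const w1 w2) => // x y.
    by have := e2 x y; rewrite k0; lra.
  case: (Req_dec (b ^ 2 + b' ^ 2) 0) => [bb0|bb0].
    apply: (align 1 0) => [||x y]; rewrite ?k0; try ring.
    by have [-> ->] := hbb x y; nra.
  have bb1 : 0 < b ^ 2 + b' ^ 2 by nra.
  have n0 : sqrt (b ^ 2 + b' ^ 2) <> 0 by apply/Rgt_not_eq/sqrt_lt_R0.
  have n2 := pow2_sqrt (b ^ 2 + b' ^ 2) (Rlt_le _ _ bb1).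
  (* Unit vector along the constant linear part (b, b'). *)
  apply: (align (b / sqrt (b ^ 2 + b' ^ 2)) (b' / sqrt (b ^ 2 + b' ^ 2))) => [||x y].
  - have -> : 1 = (b ^ 2 + b' ^ 2) / sqrt (b ^ 2 + b' ^ 2) ^ 2 by rewrite n2; field.
    by field.
  - by rewrite k0; ring.
  - by have [-> ->] := hbb x y; field.
have [m hm] := linear_part_product_const w1 w2 Om (qb0 q) (qb1 q) (qc q) k hb sO tb0 tb1
  sc k0 e1 e2 (fun x y => proj1 (proj2 (proj2 (eqs x y))))
  (fun x y => proj2 (proj2 (proj2 (eqs x y)))).
case: (Req_dec m 0) => [m0|m0].
  have [b0|b1] : (forall x y, qb0 q x y = 0) \/ (forall x y, qb1 q x y = 0).
    by apply: product_zero => // x y; rewrite hm.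
  - by apply: (align 0 1) => [||x y]; rewrite ?b0; ring.
  - by apply: (align 1 0) => [||x y]; rewrite ?b1; ring.
have [x [y nO]] := qf_nonzero _ _ _ _ _ hq.
have [h1 h2] := product_nonzero_const w1 w2 (qb0 q) (qb1 q) m hb tb0 sb1 m0 e1 hm x y.
have := e2 x y; rewrite h1 h2 => h.
have /Rmult_integral [h'|//] : - 2 * k * Om x y = 0 by lra.
by case: k0; lra.
Qed.

(** With A = a0 - a2 and B = 2 a1, the equation says that the rotated off-diagonal coefficient
    vanishes, that is, B cos(2 theta) = A sin(2 theta). The number [t] is tan(theta), a root of B
    t^2 + 2 A t - B = 0. *)
Lemma diagonalizing_angle A B :
  exists c s, c ^ 2 + s ^ 2 = 1 /\ B * (c ^ 2 - s ^ 2) = 2 * A * (c * s).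
Proof.
case: (Req_dec B 0) => [->|B0]; first by exists 1, 0; split; ring.
pose t := (- A + sqrt (A ^ 2 + B ^ 2)) / B.
have ht : B * (1 - t ^ 2) = 2 * A * t.
  have h : sqrt (A ^ 2 + B ^ 2) ^ 2 = A ^ 2 + B ^ 2 by apply: pow2_sqrt; nra.
  apply: (Rmult_eq_reg_l B) => //.
  have -> : B * (B * (1 - t ^ 2)) = B ^ 2 - (B * t) ^ 2 by ring.
  have -> : B * (2 * A * t) = 2 * A * (B * t) by ring.
  have -> : B * t = - A + sqrt (A ^ 2 + B ^ 2) by rewrite /t; field.
  have -> : (- A + sqrt (A ^ 2 + B ^ 2)) ^ 2 =
    A ^ 2 - 2 * A * sqrt (A ^ 2 + B ^ 2) + sqrt (A ^ 2 + B ^ 2) ^ 2 by ring.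
  by rewrite h; ring.
have p : 0 < 1 + t ^ 2 by nra.
have n0 : sqrt (1 + t ^ 2) <> 0 by apply/Rgt_not_eq/sqrt_lt_R0.
have n2 := pow2_sqrt (1 + t ^ 2) (Rlt_le _ _ p).
exists (/ sqrt (1 + t ^ 2)), (t / sqrt (1 + t ^ 2)); split.
  transitivity ((1 + t ^ 2) / sqrt (1 + t ^ 2) ^ 2); first by field.
  by rewrite n2; field; lra.
have -> : B * ((/ sqrt (1 + t ^ 2)) ^ 2 - (t / sqrt (1 + t ^ 2)) ^ 2) =
  B * (1 - t ^ 2) / sqrt (1 + t ^ 2) ^ 2 by field.
by rewrite ht; field.
Qed.

Lemma quadratic_flow_normal_form w1 w2 Lam Om q :
  quadratic_flow w1 w2 Lam Om q -> normal_form w1 w2 Lam Om (quad q).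
Proof.
move=> hq; have [A [B hAB]] := traceless_part_const _ _ _ _ _ hq.
have [c [s [cs1 hcs]]] := diagonalizing_angle A B.
apply: (rotate_normal_form c s) => //.
apply: (diagonal_normal_form _ _ _ _ _ ((c ^ 2 - s ^ 2) * A + 2 * (c * s) * B)).
- exact: rotate_quadratic_flow.
- move=> x y; rewrite /rotate_coeffs /rotate /=.
  by have [e1 e2] := hAB (c * x + - s * y) (s * x + c * y); rewrite -e1 -e2 in hcs; lra.
- move=> x y; rewrite /rotate_coeffs /rotate /=.
  by have [<- <-] := hAB (c * x + - s * y) (s * x + c * y); ring.
Qed.

(** * The linear integral *)

Lemma Derive_quad_slice (f0 f1 f2 f3 f4 f5 : R -> R) (t p1 p2 : R) :
  ex_derive f0 t -> ex_derive f1 t -> ex_derive f2 t ->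
  ex_derive f3 t -> ex_derive f4 t -> ex_derive f5 t ->
  Derive (fun t => f0 t * p1 ^ 2 + 2 * f1 t * p1 * p2 + f2 t * p2 ^ 2
                   + f3 t * p1 + f4 t * p2 + f5 t) t =
  Derive f0 t * p1 ^ 2 + 2 * Derive f1 t * p1 * p2 + Derive f2 t * p2 ^ 2
  + Derive f3 t * p1 + Derive f4 t * p2 + Derive f5 t.
Proof.
move=> *; apply: is_derive_unique; auto_derive; first by do !split.
rewrite -[Derive (fun t => f0 t) t]/(Derive f0 t) -[Derive (fun t => f1 t) t]/(Derive f1 t)
  -[Derive (fun t => f2 t) t]/(Derive f2 t) -[Derive (fun t => f3 t) t]/(Derive f3 t)
  -[Derive (fun t => f4 t) t]/(Derive f4 t) -[Derive (fun t => f5 t) t]/(Derive f5 t).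
ring.
Qed.

Lemma is_derive_Ham_slice (f : R -> R) (t k : R) : ex_derive f t -> 0 < f t ->
  is_derive (fun t => / (2 * f t) * k) t (- Derive f t / (2 * f t ^ 2) * k).
Proof.
move=> hf f0; auto_derive; first by do !split => //; lra.
by rewrite -[Derive (fun t => f t) t]/(Derive f t); field; lra.
Qed.

Lemma dp1_Ham Lam x y p1 p2 : 0 < Lam x y -> dp1 (Ham Lam) x y p1 p2 = p1 / Lam x y.
Proof.
by move=> h; apply: is_derive_unique; rewrite /Ham; auto_derive => //; field; lra.
Qed.

Lemma dp2_Ham Lam x y p1 p2 : 0 < Lam x y -> dp2 (Ham Lam) x y p1 p2 = p2 / Lam x y.
Proof.
by move=> h; apply: is_derive_unique; rewrite /Ham; auto_derive => //; field; lra.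
Qed.

Lemma quadratic_flow_of_integral w1 w2 Lam Om q :
  magnetic_torus w1 w2 Lam Om -> (exists x y, Om x y <> 0) ->
  torus_fun w1 w2 (qa0 q) -> torus_fun w1 w2 (qa1 q) -> torus_fun w1 w2 (qa2 q) ->
  torus_fun w1 w2 (qb0 q) -> torus_fun w1 w2 (qb1 q) -> torus_fun w1 w2 (qc q) ->
  (forall x y p1 p2, mg_bracket Om (quad q) (Ham Lam) x y p1 p2 = 0) ->
  quadratic_flow w1 w2 Lam Om q.
Proof.
move=> hT hO t0 t1 t2 u0 u1 u2 hbr; split=> // x y p1 p2.
have Lgt : 0 < Lam x y by case: hT.
have [sL _] := mt_Lam hT.
have [_ [L1 L2]] := smooth2_once _ sL x y.
have := hbr x y p1 p2; rewrite /mg_bracket dp1_Ham // dp2_Ham //.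
rewrite (_ : dx (Ham Lam) x y p1 p2 = - D1 Lam x y / (2 * Lam x y ^ 2) * (p1 ^ 2 + p2 ^ 2));
  last by apply: is_derive_unique; apply: (is_derive_Ham_slice (fun t => Lam t y)).
rewrite (_ : dy (Ham Lam) x y p1 p2 = - D2 Lam x y / (2 * Lam x y ^ 2) * (p1 ^ 2 + p2 ^ 2));
  last by apply: is_derive_unique; apply: (is_derive_Ham_slice (fun t => Lam x t)).
rewrite (_ : dp1 (quad q) x y p1 p2 = 2 * qa0 q x y * p1 + 2 * qa1 q x y * p2 + qb0 q x y);
  last by apply: is_derive_unique; rewrite /quad; auto_derive => //; ring.
rewrite (_ : dp2 (quad q) x y p1 p2 = 2 * qa1 q x y * p1 + 2 * qa2 q x y * p2 + qb1 q x y);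
  last by apply: is_derive_unique; rewrite /quad; auto_derive => //; ring.
have ed f : torus_fun w1 w2 f -> ex_derive (fun t => f t y) x /\ ex_derive (fun t => f x t) y.
  by move=> [sf _]; have [_ ?] := smooth2_once _ sf x y.
move: (ed _ t0) (ed _ t1) (ed _ t2) (ed _ u0) (ed _ u1) (ed _ u2).
move=> [? ?] [? ?] [? ?] [? ?] [? ?] [? ?].
rewrite (_ : dx (quad q) x y p1 p2 = quad (Coeffs (D1 (qa0 q)) (D1 (qa1 q)) (D1 (qa2 q))
    (D1 (qb0 q)) (D1 (qb1 q)) (D1 (qc q))) x y p1 p2); last first.
  by rewrite /dx /quad Derive_quad_slice.
rewrite (_ : dy (quad q) x y p1 p2 = quad (Coeffs (D2 (qa0 q)) (D2 (qa1 q)) (D2 (qa2 q))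
    (D2 (qb0 q)) (D2 (qb1 q)) (D2 (qc q))) x y p1 p2); last first.
  by rewrite /dy /quad Derive_quad_slice.
set A := quad _ x y p1 p2; set B := quad _ x y p1 p2 => e.
transitivity (2 * Lam x y ^ 2 * 0); last ring.
by rewrite -e; field; lra.
Qed.

(** * Independence almost everywhere *)

Lemma lebesgue2_setX (A B : set (measurableTypeR R)) :
  measurable A -> measurable B ->
  (@lebesgue_measure R \x @lebesgue_measure R)%E (A `*` B)%classic =
  (@lebesgue_measure R A * @lebesgue_measure R B)%E.
Proof. exact: product_measure1E. Qed.

Lemma lebesgue_measure_setT : @lebesgue_measure R setT = +oo%E.
Proof. by rewrite -set_itvNyy lebesgue_measure_itv. Qed.

Lemma lebesgue2_setT : (@lebesgue_measure R \x @lebesgue_measure R)%E setT = +oo%E.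
Proof.
rewrite -setXTT lebesgue2_setX; try exact: measurableT.
by rewrite lebesgue_measure_setT mulyy.
Qed.

(** Otherwise the exceptional null set would be the whole phase space, which has infinite
    measure. *)
Lemma independent_ae_exists F G : independent_ae F G ->
  exists x y p1 p2, independent_at F G x y p1 p2.
Proof.
move=> [B [mB B0 sub]]; apply: contrapT => no.
have {mB sub} BT : B = setT.
  apply/seteqP; split=> // z _; apply: sub => /= hz; apply: no.
  by do 4 eexists; exact: hz.
move: B0; rewrite BT.
have m4 : ((@lebesgue_measure R \x @lebesgue_measure R) \x
    (@lebesgue_measure R \x @lebesgue_measure R))%E setT = +oo%E.
  (* The outer product measure is by definition the integral of the measures of the sections, here
     constantly +oo. *)
  transitivity (integral (product_measure1 (@lebesgue_measure R) (@lebesgue_measure R))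
     setT (cst +oo%E)).
    apply: eq_integral => x _; rewrite /= xsectionE; exact: lebesgue2_setT.
  rewrite (integral_cst (product_measure1 (@lebesgue_measure R) (@lebesgue_measure R))).
    by apply: etrans _ mulyy; congr (_ * _)%E; exact: lebesgue2_setT.
  exact: measurableT.
by move=> B0; rewrite B0 in m4.
Qed.

(** The hyperplane p2 = 0 is null, since each of its sections over (x, y) is a line in the momentum
    plane. *)
Lemma independent_ae_off_axis (F G : phase_fun) :
  (forall x y p1 p2, p2 <> 0 -> independent_at F G x y p1 p2) -> independent_ae F G.
Proof.
move=> h.
exists (setT `*` (setT `*` [set 0]))%classic; split.
- by apply: measurableX => //; apply: measurableX.
- rewrite {1}/product_measure1.
  apply: integral0_eq => x _ /=.
  rewrite in_xsectionX ?inE //.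
  rewrite lebesgue2_setX //.
  by rewrite lebesgue_measure_set1 mule0.
- move=> [[x y] [p1 p2]] /= hn; split=> //; split=> //=.
  by apply: contrapT => p0; apply: hn => /=; apply: h.
Qed.

(** * Smoothness and independence of the linear integral *)

Lemma smooth1_Derive u : smooth1 u -> smooth1 (Derive u).
Proof.
have e n : Derive_n (Derive u) n = Derive_n u n.+1.
  by elim: n => //= n ->.
by move=> h [|n] x //=; rewrite e; apply: (h n.+2).
Qed.

Lemma smooth1_const k : smooth1 (fun _ => k).
Proof. by case=> [|n] x //; apply: (@ex_derive_n_const _ n.+1). Qed.

Lemma smooth1_ex_derive u x : smooth1 u -> ex_derive u x.
Proof. by move=> /(_ 1%nat x). Qed.

Lemma smooth2_of_smooth1 u : smooth1 u -> smooth2 (fun _ y => u y).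
Proof.
move=> su n; rewrite -/(Cn n _); elim: n u su => [|n IH] u su.
  move=> x y; split=> //; apply: (continuity_1d_2d_pt_comp u (fun _ y => y)).
    exact/continuity_pt_filterlim/ex_derive_continuous/smooth1_ex_derive.
  exact: continuity_2d_pt_id2.
apply/CnS; split.
  move=> x y; split; last by split; [apply: ex_derive_const | apply: smooth1_ex_derive].
  apply: (continuity_1d_2d_pt_comp u (fun _ y => y)).
    exact/continuity_pt_filterlim/ex_derive_continuous/smooth1_ex_derive.
  exact: continuity_2d_pt_id2.
have -> : D1 (fun _ y => u y) = fun _ _ => 0 by apply: D1_eq => x y; apply: is_derive_const.
by split; [apply: Cn_const | apply/IH/smooth1_Derive].
Qed.

Lemma continuous_p1_plus k u (z : (R * R) * (R * R)) : smooth1 u ->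
  continuous (fun z : (R * R) * (R * R) => k * fst (snd z) + u (snd (fst z))) z.
Proof.
move=> su.
apply: (continuous_plus (fun z : (R * R) * (R * R) => k * fst (snd z))
  (fun z => u (snd (fst z)))).
  apply: (continuous_scal_r k (fun z : (R * R) * (R * R) => fst (snd z))).
  apply: (continuous_comp (fun z : (R * R) * (R * R) => snd z) fst).
    exact: continuous_snd.
  exact: continuous_fst.
apply: (continuous_comp (fun z : (R * R) * (R * R) => snd (fst z)) u).
  apply: (continuous_comp (fun z : (R * R) * (R * R) => fst z) snd).
    exact: continuous_fst.
  exact: continuous_snd.
exact/ex_derive_continuous/smooth1_ex_derive.
Qed.

(** The coefficient [k] makes the class closed under all four partial derivatives, as the induction
    requires. *)
Lemma smooth4_p1_plus k u : smooth1 u -> smooth4 (fun _ y p1 _ => k * p1 + u y).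
Proof.
move=> su n; elim: n k u su => [|n IH] k u su x y p1 p2.
  by split=> //; apply: continuous_p1_plus.
split; first exact: continuous_p1_plus.
have eu := smooth1_ex_derive u y su.
split.
  by split; [|split; [|split]]; auto_derive.
have ext F G : (forall x y p1 p2, F x y p1 p2 = G x y p1 p2) -> F = G :> phase_fun.
  by move=> h; do 4 (apply/funext => ?); apply: h.
rewrite (ext (dx _) (fun _ y p1 _ => 0 * p1 + (fun _ => 0) y)); last first.
  by move=> ? t *; apply: is_derive_unique; auto_derive => //; ring.
rewrite (ext (dy _) (fun _ y p1 _ => 0 * p1 + Derive u y)); last first.
  move=> ? t *; apply: is_derive_unique; auto_derive; first exact: smooth1_ex_derive.
  by rewrite -[Derive (fun t => u t) t]/(Derive u t); ring.
rewrite (ext (dp1 _) (fun _ y p1 _ => 0 * p1 + (fun _ => k) y)); last first.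
  by move=> ? t *; apply: is_derive_unique; auto_derive => //; ring.
rewrite (ext (dp2 _) (fun _ y p1 _ => 0 * p1 + (fun _ => 0) y)); last first.
  by move=> ? t *; apply: is_derive_unique; auto_derive => //; ring.
split; [|split; [|split]]; apply: IH; try exact: smooth1_const.
exact: smooth1_Derive.
Qed.

Lemma eval2_quadratic (al be ga de : R) : exists P : {poly {poly R}},
  forall h f, eval2 P h f = al * h + be * f ^ 2 + ga * f + de.
Proof.
(* The outer variable stands for H; the polynomial in F1 sits in the constant coefficient. *)
exists (GRing.add (GRing.mul (polyC (polyC al)) (polyX _))
  (polyC (GRing.add (GRing.add (GRing.mul (polyC be) (GRing.exp (polyX _) 2))
     (GRing.mul (polyC ga) (polyX _))) (polyC de)))) => h f.
rewrite /eval2 !hornerE /= -!RplusE -!RmultE; ring.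
Qed.

(** Only two terms of the bracket survive, u' p2 / lam and Om p2 / lam, and they cancel because Om =
    - u'. Off p2 = 0 the momentum components of the differentials are already independent. *)
Lemma linear_integral v1 v2 (lam u : R -> R) :
  smooth1 u -> (forall t, 0 < lam t) ->
  (forall t, u (t + snd v1) = u t /\ u (t + snd v2) = u t) ->
  first_integral v1 v2 (fun _ y => lam y) (fun _ y => - Derive u y)
    (fun _ y p1 _ => p1 + u y).
Proof.
move=> su lam0 pu.
have eu t := smooth1_ex_derive u t su.
have d1 x y p1 p2 : dx (fun _ y p1 _ => p1 + u y) x y p1 p2 = 0 by apply: Derive_const.
have d2 x y p1 p2 : dy (fun _ y p1 _ => p1 + u y) x y p1 p2 = Derive u y.
  apply: is_derive_unique; auto_derive; first exact: eu.
  by rewrite -[Derive (fun t => u t) y]/(Derive u y); ring.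
have d3 x y p1 p2 : dp1 (fun _ y p1 _ => p1 + u y) x y p1 p2 = 1.
  by apply: is_derive_unique; auto_derive => //; ring.
have d4 x y p1 p2 : dp2 (fun _ y p1 _ => p1 + u y) x y p1 p2 = 0.
  exact: Derive_const.
have d5 x y p1 p2 : dx (Ham (fun _ y => lam y)) x y p1 p2 = 0 by apply: Derive_const.
split.
- split; last by move=> x y p1 p2; have [-> ->] := pu y.
  rewrite (_ : (fun _ y p1 _ => p1 + u y) = (fun _ y p1 _ => 1 * p1 + u y) :> phase_fun).
    exact: smooth4_p1_plus.
  by do 4 (apply/funext => ?); ring.
- move=> x y p1 p2; rewrite /mg_bracket d1 d2 d3 d4 d5 dp1_Ham // dp2_Ham //.
  by ring.
- apply: independent_ae_off_axis => x y p1 p2 p0 a b _ _.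
  rewrite d3 d4 dp1_Ham // dp2_Ham // => h1 h2.
  have b0 : b = 0.
    have /Rmult_integral [//|h] : b * (p2 / lam y) = 0 by lra.
    have : p2 = p2 / lam y * lam y by field; have := lam0 y; lra.
    by rewrite h Rmult_0_l.
  by split=> //; rewrite b0 in h1; lra.
Qed.

(** An affine relation gives dF - al dH = 0 everywhere, whereas independence holds at one point at
    least. *)
Lemma independent_not_affine Lam F al de : smooth2 Lam -> (forall x y, 0 < Lam x y) ->
  independent_ae F (Ham Lam) ->
  ~ forall x y p1 p2, F x y p1 p2 = al * Ham Lam x y p1 p2 + de.
Proof.
move=> sL L0 /independent_ae_exists [x [y [p1 [p2 h]]]] hF.
have aff (g : R -> R) t : ex_derive g t -> Derive (fun t => al * g t + de) t = al * Derive g t.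
  move=> hg; apply: is_derive_unique; auto_derive => //.
  by rewrite -[Derive (fun t => g t) t]/(Derive g t); ring.
have [_ [L1 L2]] := smooth2_once _ sL x y.
have FE : F = fun x y p1 p2 => al * Ham Lam x y p1 p2 + de.
  by do 4 (apply/funext => ?); apply: hF.
have [] := h 1 (- al); rewrite ?FE; last by lra.
- rewrite /dx (aff (fun t => Ham Lam t y p1 p2)); first ring.
  by eexists; apply: (is_derive_Ham_slice (fun t => Lam t y)).
- rewrite /dy (aff (fun t => Ham Lam x t p1 p2)); first ring.
  by eexists; apply: (is_derive_Ham_slice (fun t => Lam x t)).
- rewrite /dp1 (aff (fun t => Ham Lam x y t p2)); first ring.
  by rewrite /Ham; auto_derive.
- rewrite /dp2 (aff (fun t => Ham Lam x y p1 t)); first ring.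
  by rewrite /Ham; auto_derive.
Qed.

Lemma rotation_coordinate_change w1 w2 c s : c ^ 2 + s ^ 2 = 1 ->
  coordinate_change w1 w2 (rotate_pt c s w1) (rotate_pt c s w2)
    (fun x y => c * x + s * y) (fun x y => c * y - s * x).
Proof.
move=> cs1.
have sY : smooth2 (fun x y => c * y - s * x).
  rewrite (_ : (fun x y => c * y - s * x) = fun x y => - s * x + c * y).
    exact: smooth2_lin.
  by apply/funext=> x; apply/funext=> y; ring.
split; first by split=> //; apply: smooth2_lin.
- exists (fun x y => c * x + - s * y), (fun x y => s * x + c * y).
  split; first by split; apply: smooth2_lin.
  by split=> x y; split; rewrite -[RHS]Rmult_1_l -cs1; ring.
- by move=> x y; rewrite /rotate_pt /=; split; ring.
- by move=> x y; rewrite /rotate_pt /=; split; ring.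
Qed.

Theorem theorem2 (w1 w2 : R * R) (Lam Om : R -> R -> R) (F2 : phase_fun)
    (hT : magnetic_torus w1 w2 Lam Om)
    (hOm : exists x y : R, Om x y <> 0)
    (hF2 : first_integral w1 w2 Lam Om F2)
    (hquad : quadratic_in_momenta w1 w2 F2) :
  exists (v1 v2 : R * R) (X Y : R -> R -> R) (lam u : R -> R),
    coordinate_change w1 w2 v1 v2 X Y /\
    smooth1 lam /\ smooth1 u /\
    let Lam' := fun _ y : R => lam y in
    let Om' := fun _ y : R => - Derive u y in
    let F1 := fun _ y p1 _ : R => p1 + u y in
    magnetic_torus v1 v2 Lam' Om' /\
    same_metric X Y Lam Lam' /\
    same_form X Y Om Om' /\
    first_integral v1 v2 Lam' Om' F1 /\
    exists P : {poly {poly R}},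
      same_phase_fun X Y F2
        (fun x y p1 p2 => eval2 P (Ham Lam' x y p1 p2) (F1 x y p1 p2)).
Proof.
have [a0 [a1 [a2 [b0 [b1 [c0 [[t0 [t1 [t2 [r0 [r1 r2]]]]] hF]]]]]]] := hquad.
pose q := Coeffs a0 a1 a2 b0 b1 c0.
have F2E : F2 = quad q by do 4 (apply/funext => ?); apply: hF.
have [hb [sL pL] L0 [sO pO]] := hT.
have hq : quadratic_flow w1 w2 Lam Om q.
  apply: quadratic_flow_of_integral => // x y p1 p2.
  by rewrite -F2E; case: hF2.
have := quadratic_flow_normal_form _ _ _ _ _ hq; rewrite -F2E.
case=> [|[al [de aff]]]; last first.
  by case: (independent_not_affine _ _ al de sL L0 (fi_independent hF2)).
move=> [c [s [lam [u [al [be [ga [de [cs1 [slam [su [eL [eO [pu eF]]]]]]]]]]]]]].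
(* The point (- s t, c t) has Y = t, so facts about f(Y) on the plane yield facts about [f] on all
   of R. *)
have onto t : c * (c * t) - s * (- s * t) = t by rewrite -[RHS]Rmult_1_l -cs1; ring.
(* The periods of [f] are the Y-components of the rotated lattice vectors. *)
have descend (f : R -> R) : doubly_periodic w1 w2 (fun x y => f (c * y - s * x)) ->
    forall t, f (t + snd (rotate_pt c s w1)) = f t /\ f (t + snd (rotate_pt c s w2)) = f t.
  move=> pf t; have [h1 h2] := pf (- s * t) (c * t); rewrite onto in h1 h2.
  split; [rewrite -h1 | rewrite -h2]; congr f; rewrite /rotate_pt /=;
    by rewrite -{1}(onto t); ring.
have plam : doubly_periodic w1 w2 (fun x y => lam (c * y - s * x)).
  by move=> x y; rewrite -!eL; apply: pL.
have pom : doubly_periodic w1 w2 (fun x y => - Derive u (c * y - s * x)).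
  by move=> x y; rewrite -!eO; apply: pO.
have lam0 t : 0 < lam t by rewrite -(onto t) -eL.
have DX x y : D1 (fun x y => c * x + s * y) x y = c /\ D2 (fun x y => c * x + s * y) x y = s.
  by split; apply: is_derive_unique; auto_derive => //; ring.
have DY x y : D1 (fun x y => c * y - s * x) x y = - s /\ D2 (fun x y => c * y - s * x) x y = c.
  by split; apply: is_derive_unique; auto_derive => //; ring.
exists (rotate_pt c s w1), (rotate_pt c s w2), (fun x y => c * x + s * y),
  (fun x y => c * y - s * x), lam, u.
split; first exact: rotation_coordinate_change.
do 2 split=> //.
split.
  split.
  - exact: is_basis_rotate.
  - by split; [exact: smooth2_of_smooth1 | move=> _ y; apply: descend].
  - by move=> _ y.
  - split; last by move=> _ y; apply: (descend (fun t => - Derive u t)).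
    rewrite (_ : (fun _ y => - Derive u y) = fun _ y => -1 * Derive u y).
      exact/smooth2_scal/smooth2_of_smooth1/smooth1_Derive.
    by apply/funext=> x; apply/funext=> y; ring.
split.
  move=> x y a b; have [-> ->] := DX x y; have [-> ->] := DY x y; rewrite eL.
  by congr (_ * _); rewrite -[LHS]Rmult_1_l -cs1; ring.
split.
  move=> x y; have [-> ->] := DX x y; have [-> ->] := DY x y; rewrite eO.
  by rewrite -[LHS]Rmult_1_r -cs1; ring.
split; first by apply: linear_integral => //; apply: descend.
have [P hP] := eval2_quadratic al be ga de.
exists P => x y P1 P2; have [-> ->] := DX x y; have [-> ->] := DY x y.
rewrite eF hP /= /Ham eL.
have -> : c * (P1 * c + P2 * - s) + s * (P1 * s + P2 * c) = P1.
  by rewrite -[RHS]Rmult_1_l -cs1; ring.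
have -> // : (P1 * c + P2 * - s) ^ 2 + (P1 * s + P2 * c) ^ 2 = P1 ^ 2 + P2 ^ 2.
by rewrite -[RHS]Rmult_1_l -cs1; ring.
Qed.
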